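(* Let $(Z,Z_{ac},h)$ be a normal accretive operator space. Then there exist a Hilbert space $H$ and a real-complete order embedding $\phi:Z\to B(H)$ such that $h_n(z)=\|\operatorname{Re}(\phi^{(n)}(z))\|_{B(H^n)}$ for all $n$ and all $z\in M_n(Z)$.
   Context: For a complex vector space $Z$, $M_n(Z)$ denotes the $n\times n$ matrices over $Z$; for scalar $X\in M_{n,k}$ and $A\in M_n(Z)$, $X^*AX$ is defined by matrix multiplication; $A\oplus B$ is the block diagonal matrix. A cone is a set $C$ with $C+C\subseteq C$, $tC\subseteq C$ for $t\ge0$; a matrix cone is a sequence of cones $C_n\subseteq M_n(Z)$ with $X^*C_nX\subseteq C_k$ for all $X\in M_{n,k}$; it is $\mathbb{C}$-proper if $C_1\cap-C_1\cap iC_1\cap-iC_1=\{0\}$, and then $(Z,Z_{ac})$ with $Z_{ac}=\{Z_{ac}^n\}$ is an accretive matrix-ordered vector space. A matrix gauge on $Z$ is a sequence $\{\nu_n:M_n(Z)\to[0,\infty)\}$ with $\nu_n(x+y)\le\nu_n(x)+\nu_n(y)$, $\nu_n(tx)=t\nu_n(x)$ ($t\ge0$), $\nu_k(X^*AX)\le\|X\|^2\nu_n(A)$, and $\nu_{n+m}(A\oplus B)=\max\{\nu_n(A),\nu_m(B)\}$; it is $\mathbb{C}$-proper if $\nu_1(i^kz)=0$ for $k=0,1,2,3$ implies $z=0$. A hermitian matrix gauge is a $\mathbb{C}$-proper matrix gauge $h$ with $h_n(tz)=|t|h_n(z)$ for all real $t$. Given an accretive matrix-ordered vector space $(Z,Z_{ac})$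 and a hermitian matrix gauge $h$, $Z_{ac}$ is $h$-closed if whenever $z_k\in Z_{ac}^n$ and $h_n(z_k-z)\to0$ then $z\in Z_{ac}^n$. $(Z,Z_{ac},h)$ is a normal accretive operator space if $Z_{ac}$ is $h$-closed and whenever $y-x,\ z-y\in Z_{ac}^n$ we have $h_n(y)\le\max\{h_n(x),h_n(z)\}$. For a Hilbert space $H$, $M_n(B(H))=B(H^n)$, $\operatorname{Re}(T)=\frac12(T+T^* )$, and $B(H)$ carries the accretive cones $\{T\in B(H^n):\operatorname{Re}T\ge0\}$. A linear map $\phi$ is real-completely positive if $\phi^{(n)}$ (entrywise) maps accretive cones into accretive cones for all $n$; a real-complete order embedding is an injective such $\phi$ whose inverse on its range is also real-completely positive. *)

(* Defs.v *)
From Stdlib Require Import Reals.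
From mathcomp Require Import all_boot.
Set Implicit Arguments. Unset Strict Implicit. Unset Printing Implicit Defensive.
Open Scope R_scope.

Record C := mkC { re : R ; im : R }.
Definition C0 : C := mkC 0 0.
Definition C1 : C := mkC 1 0.
Definition Ci : C := mkC 0 1.
Definition RtoC (r : R) : C := mkC r 0.
Definition Cadd (a b : C) : C := mkC (re a + re b) (im a + im b).
Definition Copp (a : C) : C := mkC (- re a) (- im a).
Definition Cmul (a b : C) : C :=
  mkC (re a * re b - im a * im b) (re a * im b + im a * re b).
Definition Cconj (a : C) : C := mkC (re a) (- im a).
Definition Cmod (a : C) : R := sqrt (re a * re a + im a * im a).
Fixpoint Cpow (a : C) (k : nat) : C :=
  match k with O => C1 | S k' => Cmul a (Cpow a k') end.

Record CVS := {
  vcar :> Type;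
  vzero : vcar;
  vadd : vcar -> vcar -> vcar;
  vopp : vcar -> vcar;
  vscal : C -> vcar -> vcar;
  vaddA : forall x y z, vadd x (vadd y z) = vadd (vadd x y) z;
  vaddC : forall x y, vadd x y = vadd y x;
  vadd0 : forall x, vadd vzero x = x;
  vaddN : forall x, vadd (vopp x) x = vzero;
  vscalDr : forall c x y, vscal c (vadd x y) = vadd (vscal c x) (vscal c y);
  vscalDl : forall c d x, vscal (Cadd c d) x = vadd (vscal c x) (vscal d x);
  vscalA : forall c d x, vscal (Cmul c d) x = vscal c (vscal d x);
  vscal1 : forall x, vscal C1 x = x
}.

Definition mx (Z : CVS) (m n : nat) := 'I_m -> 'I_n -> Z.
Definition mx0 (Z : CVS) m n : mx Z m n := fun _ _ => @vzero Z.
Definition mxadd (Z : CVS) m n (A B : mx Z m n) : mx Z m n :=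
  fun i j => vadd (A i j) (B i j).
Definition mxopp (Z : CVS) m n (A : mx Z m n) : mx Z m n :=
  fun i j => vopp (A i j).
Definition mxsub (Z : CVS) m n (A B : mx Z m n) : mx Z m n := mxadd A (mxopp B).
Definition mxscal (Z : CVS) m n (c : C) (A : mx Z m n) : mx Z m n :=
  fun i j => vscal c (A i j).

Definition cmx (m n : nat) := 'I_m -> 'I_n -> C.

Definition congr_mx (Z : CVS) n k (X : cmx n k) (A : mx Z n n) : mx Z k k :=
  fun a b => \big[@vadd Z/@vzero Z]_(i < n) \big[@vadd Z/@vzero Z]_(j < n)
               vscal (Cmul (Cconj (X i a)) (X j b)) (A i j).

Definition dsum (Z : CVS) n m (A : mx Z n n) (B : mx Z m m) : mx Z (n + m)%N (n + m)%N :=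
  fun i j => match split i, split j with
             | inl i', inl j' => A i' j'
             | inr i', inr j' => B i' j'
             | _, _ => @vzero Z
             end.

Definition cvec_norm n (v : 'I_n -> C) : R :=
  sqrt (\big[Rplus/0]_(i < n) (re (v i) * re (v i) + im (v i) * im (v i))).
Definition cmx_app n k (X : cmx n k) (v : 'I_k -> C) : 'I_n -> C :=
  fun i => \big[Cadd/C0]_(j < k) Cmul (X i j) (v j).
Definition cmx_norm_is n k (X : cmx n k) (r : R) : Prop :=
  is_lub (fun s => exists v, cvec_norm v <= 1 /\ s = cvec_norm (cmx_app X v)) r.

Definition is_cone (Z : CVS) n (K : mx Z n n -> Prop) : Prop :=
  (forall x y, K x -> K y -> K (mxadd x y)) /\
  (forall (t : R) x, 0 <= t -> K x -> K (mxscal (RtoC t) x)).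

Definition matrix_cone (Z : CVS) (K : forall n, mx Z n n -> Prop) : Prop :=
  (forall n, is_cone (K n)) /\
  (forall n k (X : cmx n k) (A : mx Z n n), K n A -> K k (congr_mx X A)).

Definition C_proper_cone (Z : CVS) (K : forall n, mx Z n n -> Prop) : Prop :=
  forall z : mx Z 1%N 1%N,
    (K 1%N z /\ (exists w, K 1%N w /\ z = mxopp w)
     /\ (exists w, K 1%N w /\ z = mxscal Ci w)
     /\ (exists w, K 1%N w /\ z = mxscal (Copp Ci) w))
    <-> z = @mx0 Z 1%N 1%N.

Definition accretive_mxos (Z : CVS) (K : forall n, mx Z n n -> Prop) : Prop :=
  matrix_cone K /\ C_proper_cone K.

Definition matrix_gauge (Z : CVS) (nu : forall n, mx Z n n -> R) : Prop :=
  (forall n x, 0 <= nu n x) /\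
  (forall n x y, nu n (mxadd x y) <= nu n x + nu n y) /\
  (forall n (t : R) x, 0 <= t -> nu n (mxscal (RtoC t) x) = t * nu n x) /\
  (forall n k (X : cmx n k) (A : mx Z n n) (r : R),
      cmx_norm_is X r -> nu k (congr_mx X A) <= r ^ 2 * nu n A) /\
  (forall n m (A : mx Z n n) (B : mx Z m m),
      nu (n + m)%N (dsum A B) = Rmax (nu n A) (nu m B)).

Definition C_proper_gauge (Z : CVS) (nu : forall n, mx Z n n -> R) : Prop :=
  forall z : mx Z 1%N 1%N,
    (forall k : nat, (k < 4)%N -> nu 1%N (mxscal (Cpow Ci k) z) = 0) ->
    z = @mx0 Z 1%N 1%N.

Definition hermitian_gauge (Z : CVS) (h : forall n, mx Z n n -> R) : Prop :=
  matrix_gauge h /\ C_proper_gauge h /\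
  (forall n (t : R) x, h n (mxscal (RtoC t) x) = Rabs t * h n x).

Definition h_closed (Z : CVS) (K : forall n, mx Z n n -> Prop)
  (h : forall n, mx Z n n -> R) : Prop :=
  forall n (zs : nat -> mx Z n n) (z : mx Z n n),
    (forall k, K n (zs k)) -> Un_cv (fun k => h n (mxsub (zs k) z)) 0 -> K n z.

Definition normal_accretive_operator_space (Z : CVS)
  (K : forall n, mx Z n n -> Prop) (h : forall n, mx Z n n -> R) : Prop :=
  accretive_mxos K /\ hermitian_gauge h /\ h_closed K h /\
  (forall n (x y z : mx Z n n), K n (mxsub y x) -> K n (mxsub z y) ->
      h n y <= Rmax (h n x) (h n z)).

Record Hilbert := {
  hvs :> CVS;
  inner : hvs -> hvs -> C;
  innerDl : forall x y z, inner (vadd x y) z = Cadd (inner x z) (inner y z);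
  innerZl : forall c x y, inner (vscal c x) y = Cmul c (inner x y);
  innerC : forall x y, inner y x = Cconj (inner x y);
  inner_ge0 : forall x, 0 <= re (inner x x);
  inner_eq0 : forall x, inner x x = C0 -> x = @vzero hvs;
  hcomplete : forall u : nat -> hvs,
    (forall eps, eps > 0 -> exists N, forall m n, (N <= m)%N -> (N <= n)%N ->
        sqrt (re (inner (vadd (u m) (vopp (u n))) (vadd (u m) (vopp (u n))))) < eps) ->
    exists l, forall eps, eps > 0 -> exists N, forall n, (N <= n)%N ->
        sqrt (re (inner (vadd (u n) (vopp l)) (vadd (u n) (vopp l)))) < eps
}.

Definition hnorm (H : Hilbert) (x : H) : R := sqrt (re (inner x x)).

(* bounded linear operators on H, packaged with their (unique) adjoint *)
Record Bop (H : Hilbert) := {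
  bop :> H -> H;
  badj : H -> H;
  bop_add : forall x y, bop (vadd x y) = vadd (bop x) (bop y);
  bop_scal : forall c x, bop (vscal c x) = vscal c (bop x);
  bop_bounded : exists M, forall x, hnorm (bop x) <= M * hnorm x;
  bop_adj : forall x y, inner (bop x) y = inner x (badj y)
}.

Definition innerN (H : Hilbert) n (x y : 'I_n -> H) : C :=
  \big[Cadd/C0]_(i < n) inner (x i) (y i).
Definition normN (H : Hilbert) n (x : 'I_n -> H) : R := sqrt (re (innerN x x)).
Definition opmx (H : Hilbert) n (S : 'I_n -> 'I_n -> H -> H) (x : 'I_n -> H) : 'I_n -> H :=
  fun i => \big[@vadd H/vzero H]_(j < n) S i j (x j).

(* Re(T) = (T + T-star)/2 for T in M_n(B(H)) = B(H^n); T-star has entries adj(T_ji) *)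
Definition ReM (H : Hilbert) n (T : 'I_n -> 'I_n -> Bop H) : 'I_n -> 'I_n -> H -> H :=
  fun i j x => vscal (RtoC (1/2)) (vadd (T i j x) (badj (T j i) x)).

Definition positive_op (H : Hilbert) n (S : 'I_n -> 'I_n -> H -> H) : Prop :=
  forall x : 'I_n -> H, im (innerN (opmx S x) x) = 0 /\ 0 <= re (innerN (opmx S x) x).

Definition accretive_op (H : Hilbert) n (T : 'I_n -> 'I_n -> Bop H) : Prop :=
  positive_op (ReM T).

Definition opnorm_is (H : Hilbert) n (S : 'I_n -> 'I_n -> H -> H) (r : R) : Prop :=
  is_lub (fun s => exists x : 'I_n -> H, normN x <= 1 /\ s = normN (opmx S x)) r.

Definition ampl (Z : CVS) (H : Hilbert) (phi : Z -> Bop H) n (z : mx Z n n) :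
  'I_n -> 'I_n -> Bop H := fun i j => phi (z i j).

Definition linear_map (Z : CVS) (H : Hilbert) (phi : Z -> Bop H) : Prop :=
  (forall z w x, phi (vadd z w) x = vadd (phi z x) (phi w x)) /\
  (forall c z x, phi (vscal c z) x = vscal c (phi z x)).

Definition real_completely_positive (Z : CVS) (K : forall n, mx Z n n -> Prop)
  (H : Hilbert) (phi : Z -> Bop H) : Prop :=
  linear_map phi /\ forall n (z : mx Z n n), K n z -> accretive_op (ampl phi z).

(* injective, RCP, and the inverse on the range (phi^(n)(z) |-> z) is RCP *)
Definition real_complete_order_embedding (Z : CVS) (K : forall n, mx Z n n -> Prop)
  (H : Hilbert) (phi : Z -> Bop H) : Prop :=
  real_completely_positive K phi /\
  (forall z w, (forall x, phi z x = phi w x) -> z = w) /\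
  (forall n (z : mx Z n n), accretive_op (ampl phi z) -> K n z).

(* Main.v *)
(** Put Z' = Z x C and let G_n ([Gcone]) be the cone in M_n(Z') of all
    (X^* A X + k, X^* X + S) with h(A) <= 1, k in K_n and S positive semidefinite.
    These form a matrix cone for which (0, 1) is an order unit; a functional on
    M_n(Z') that is positive on G_n is a pair (g, p) with g >= 0 on K_n, p positive
    and |g(X^* A X)| <= p(X^* X) h(A).  It turns C^n into a semi-inner product space
    (from p) carrying bounded sesquilinear forms indexed by Z (from g).  Every
    inequality that the representation on H must satisfy says that a matrix form is
    nonnegative on G_m, and it holds on the completed direct sum of these spaces over
    all n and all positive functionals.

    Conversely, (-z, t) in G_n forces h(z + k) <= t for some k in K_n, so
    Hahn-Banach yields positive functionals with p(1) <= 1 and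
    g(z) >= inf_k h(z + k).  By normality this infimum equals h(z) for z or for -z,
    and when K is h-closed the infimum for -z is positive as soon as z is not in K. *)

From HB Require Import structures.
From Stdlib Require Import Reals Lra.
From mathcomp Require Import all_boot.
From mathcomp Require Import boolp classical_sets.
Require Import Defs.
Set Implicit Arguments. Unset Strict Implicit. Unset Printing Implicit Defensive.
Open Scope R_scope.

(** * Complex numbers and complex vector spaces *)

(** The scalar coordinate turns the gauge into order: for r > h(z) both (z, r) and (-z, r) lie in
    G_n, so the two-sided bound on Re phi(z) is itself a pair of positivity statements, and
    separation from a single family of cones controls norm and order together. Z carries no
    involution, so a positive functional f is only real-linear; the forms come from its
    complex-linear extension f(M) - i f(iM). The order unit bounds each form by a constant that
    depends on the element of Z alone and not on the functional. This is why the sum over all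
    positive functionals still carries bounded operators. No quotient by null vectors is taken: the
    Hilbert space consists of bounded antilinear functionals, and every identity on it is obtained
    by letting the error of an approximate representing vector tend to 0. Normality enters as
    follows: if k, l are in K_n then z lies between z - l and z + k, so h(z) cannot exceed both h(z
    - l) and h(z + k). *)

Lemma Ceq (a b : C) : re a = re b -> im a = im b -> a = b.
Proof. by case: a b => a1 a2 [b1 b2] /= -> ->. Qed.

Ltac Cring := apply: Ceq; rewrite /=; ring.

Lemma CaddA (a b c : C) : Cadd a (Cadd b c) = Cadd (Cadd a b) c.
Proof. Cring. Qed.
Lemma CaddC (a b : C) : Cadd a b = Cadd b a.
Proof. Cring. Qed.
Lemma Cadd0 (a : C) : Cadd C0 a = a.
Proof. Cring. Qed.

HB.instance Definition _ := Monoid.isComLaw.Build C C0 Cadd CaddA CaddC Cadd0.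
HB.instance Definition _ (Z : CVS) :=
  Monoid.isComLaw.Build Z (@vzero Z) (@vadd Z) (@vaddA Z) (@vaddC Z) (@vadd0 Z).

Lemma RplusA (a b c : R) : a + (b + c) = a + b + c.
Proof. ring. Qed.
Lemma RplusC (a b : R) : a + b = b + a.
Proof. ring. Qed.
Lemma Rplus0 (a : R) : 0 + a = a.
Proof. ring. Qed.
HB.instance Definition _ := Monoid.isComLaw.Build R 0 Rplus RplusA RplusC Rplus0.

Definition Csq (a : C) : R := re a * re a + im a * im a.

Lemma Csq_ge0 a : 0 <= Csq a.
Proof. rewrite /Csq; nra. Qed.

Lemma CmodE a : Cmod a = sqrt (Csq a).
Proof. by []. Qed.

Lemma Cmod_ge0 a : 0 <= Cmod a.
Proof. exact: sqrt_pos. Qed.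

Lemma Cmod_sq a : Cmod a * Cmod a = Csq a.
Proof. by rewrite CmodE sqrt_sqrt //; apply: Csq_ge0. Qed.

Lemma sqr_le (x y : R) : 0 <= y -> x * x <= y * y -> x <= y.
Proof. nra. Qed.

Lemma Cmod_le a r : 0 <= r -> Csq a <= r * r -> Cmod a <= r.
Proof. by move=> r0 ar; apply: sqr_le => //; rewrite Cmod_sq. Qed.

Lemma CmodM a b : Cmod (Cmul a b) = Cmod a * Cmod b.
Proof.
rewrite !CmodE -sqrt_mult; try exact: Csq_ge0.
congr sqrt; rewrite /Csq /=; ring.
Qed.

Lemma CmodD a b : Cmod (Cadd a b) <= Cmod a + Cmod b.
Proof.
have a0 := Cmod_ge0 a; have b0 := Cmod_ge0 b.
apply: Cmod_le; first lra.
have := Cmod_sq a; have := Cmod_sq b; rewrite /Csq /= => hb ha.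
have : re a * re b + im a * im b <= Cmod a * Cmod b.
  apply: sqr_le; first nra.
  have -> : Cmod a * Cmod b * (Cmod a * Cmod b) =
     (Cmod a * Cmod a) * (Cmod b * Cmod b) by ring.
  rewrite ha hb.
  have := Rle_0_sqr (re a * im b - im a * re b); rewrite /Rsqr; nra.
nra.
Qed.

Lemma Cmod_conj a : Cmod (Cconj a) = Cmod a.
Proof. by rewrite /Cmod /=; congr sqrt; ring. Qed.

Lemma Cmod_opp a : Cmod (Copp a) = Cmod a.
Proof. by rewrite /Cmod /=; congr sqrt; ring. Qed.

Lemma Rabs_le_sq x y : 0 <= y -> x * x <= y * y -> Rabs x <= y.
Proof. by move=> y0 h; apply: Rabs_le; nra. Qed.

Lemma re_le_Cmod a : Rabs (re a) <= Cmod a.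
Proof.
apply: Rabs_le_sq; first exact: Cmod_ge0.
rewrite Cmod_sq /Csq; nra.
Qed.

Lemma im_le_Cmod a : Rabs (im a) <= Cmod a.
Proof.
apply: Rabs_le_sq; first exact: Cmod_ge0.
rewrite Cmod_sq /Csq; nra.
Qed.

Lemma Cmod_le_reim a : Cmod a <= Rabs (re a) + Rabs (im a).
Proof.
have ha := Rabs_pos (re a); have hb := Rabs_pos (im a).
apply: Cmod_le; first lra.
have h1 : re a * re a = Rabs (re a) * Rabs (re a) by rewrite -Rabs_mult Rabs_right //; nra.
have h2 : im a * im a = Rabs (im a) * Rabs (im a) by rewrite -Rabs_mult Rabs_right //; nra.
rewrite /Csq h1 h2; nra.
Qed.

Lemma Cmod0 : Cmod C0 = 0.
Proof. by rewrite /Cmod /= !Rmult_0_l Rplus_0_l sqrt_0. Qed.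

Lemma Cmod_RtoC r : Cmod (RtoC r) = Rabs r.
Proof. rewrite /Cmod /= Rmult_0_l Rplus_0_r; exact: sqrt_Rsqr_abs. Qed.

Lemma Cmod_eq0 a : Cmod a <= 0 -> a = C0.
Proof.
move=> h; have h1 := re_le_Cmod a; have h2 := im_le_Cmod a.
move: h1 h2; rewrite /Rabs; do 2 case: Rcase_abs => ?; move=> *; apply: Ceq => /=; lra.
Qed.

Definition Csub a b := Cadd a (Copp b).

Lemma Csub_eq0 a b : Csub a b = C0 -> a = b.
Proof. by move=> h; have := f_equal re h; have := f_equal im h => /= ? ?; apply: Ceq; lra. Qed.

Lemma re_Csub a b : re (Csub a b) = re a - re b.
Proof. by []. Qed.

Lemma re_conj a : re (Cconj a) = re a.
Proof. by []. Qed.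

Lemma re_le a : re a <= Cmod a.
Proof. by have := re_le_Cmod a; have := Rle_abs (re a); lra. Qed.

Lemma Nre_le a : - re a <= Cmod a.
Proof. by have := re_le_Cmod a; have := Rle_abs (- re a); rewrite Rabs_Ropp; lra. Qed.

Lemma CsubC a b : Cmod (Csub a b) = Cmod (Csub b a).
Proof. by rewrite -Cmod_opp; congr Cmod; Cring. Qed.

Lemma Csub_tri b a c : Cmod (Csub a c) <= Cmod (Csub a b) + Cmod (Csub b c).
Proof. by have -> : Csub a c = Cadd (Csub a b) (Csub b c); [Cring | exact: CmodD]. Qed.

Lemma CsubD a a' b b' :
  Cmod (Csub (Cadd a a') (Cadd b b')) <= Cmod (Csub a b) + Cmod (Csub a' b').
Proof.
by have -> : Csub (Cadd a a') (Cadd b b') = Cadd (Csub a b) (Csub a' b');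
  [Cring | exact: CmodD].
Qed.

(** If a > 0 then k > 0, and e = a / (2k), or e = 1 when that is smaller, is contradictory.
    Restricting to e <= 1 lets users of the lemma absorb quadratic errors into the constant k. *)
Lemma le_eps a k : (forall e, 0 < e -> e <= 1 -> a <= k * e) -> a <= 0.
Proof.
move=> h; case: (Rle_lt_dec a 0) => // a0.
have k0 : 0 < k by have := h 1; lra.
have h1 : 0 < a / (2 * k) by apply: Rdiv_lt_0_compat; lra.
case: (Rle_lt_dec (a / (2 * k)) 1) => h2.
  have := h _ h1 h2.
  have -> : k * (a / (2 * k)) = a / 2 by field; lra.
  lra.
have := h 1; rewrite Rmult_1_r => h3.
have : a / (2 * k) <= 1.
  by apply: (Rmult_le_reg_r (2 * k)); first lra; rewrite /Rdiv Rmult_assoc Rinv_l; lra.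
lra.
Qed.

Lemma Ceq_eps a b k : (forall e, 0 < e -> e <= 1 -> Cmod (Csub a b) <= k * e) -> a = b.
Proof. by move=> h; apply/Csub_eq0/Cmod_eq0/(le_eps h). Qed.

(** * Consequences of the vector space axioms; products and matrix spaces *)

Section CVSTheory.
Variable Z : CVS.
Implicit Types x y z : Z.

Lemma vaddACA x y z w : vadd (vadd x y) (vadd z w) = vadd (vadd x z) (vadd y w).
Proof. by rewrite -!vaddA (vaddA y) (vaddC y) -!vaddA. Qed.

Lemma vaddr0 x : vadd x (@vzero Z) = x.
Proof. by rewrite vaddC vadd0. Qed.

Lemma vaddrN x : vadd x (vopp x) = vzero Z.
Proof. by rewrite vaddC vaddN. Qed.

Lemma vadd_inj x y z : vadd x y = vadd x z -> y = z.
Proof. by move=> h; rewrite -(vadd0 y) -(vadd0 z) -(vaddN x) -!vaddA h. Qed.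

Lemma vscal0 x : vscal C0 x = vzero Z.
Proof.
apply: (@vadd_inj (vscal C0 x)); rewrite vaddr0 -vscalDl; congr vscal; Cring.
Qed.

Lemma vscalr0 c : vscal c (vzero Z) = vzero Z.
Proof. by rewrite -(vscal0 (vzero Z)) -vscalA; congr vscal; Cring. Qed.

Lemma voppE x : vopp x = vscal (RtoC (-1)) x.
Proof.
apply: (@vadd_inj x); rewrite vaddrN -{1}(vscal1 x) -vscalDl -(vscal0 x).
congr vscal; Cring.
Qed.

Lemma voppK x : vopp (vopp x) = x.
Proof. by rewrite !voppE -vscalA -[RHS]vscal1; congr vscal; Cring. Qed.

Lemma voppD x y : vopp (vadd x y) = vadd (vopp x) (vopp y).
Proof. by rewrite !voppE vscalDr. Qed.

Lemma vopp0 : vopp (vzero Z) = vzero Z.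
Proof. by rewrite voppE vscalr0. Qed.

Lemma vscalN c x : vscal c (vopp x) = vopp (vscal c x).
Proof. by rewrite !voppE -!vscalA; congr vscal; Cring. Qed.

Lemma vaddKN x y : vadd (vadd x y) (vopp y) = x.
Proof. by rewrite -vaddA vaddrN vaddr0. Qed.

Lemma vaddNK x y : vadd (vadd x (vopp y)) y = x.
Proof. by rewrite -vaddA vaddN vaddr0. Qed.

Lemma vscal_sum c (I : Type) (r : seq I) (F : I -> Z) :
  vscal c (\big[@vadd Z/@vzero Z]_(i <- r) F i)
  = \big[@vadd Z/@vzero Z]_(i <- r) vscal c (F i).
Proof. by apply: big_morph => [? ?|]; [exact: vscalDr | exact: vscalr0]. Qed.

End CVSTheory.

Lemma CmulA a b c : Cmul a (Cmul b c) = Cmul (Cmul a b) c.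
Proof. Cring. Qed.
Lemma CaddN a : Cadd (Copp a) a = C0.
Proof. Cring. Qed.
Lemma CmulDr c x y : Cmul c (Cadd x y) = Cadd (Cmul c x) (Cmul c y).
Proof. Cring. Qed.
Lemma CmulDl c d x : Cmul (Cadd c d) x = Cadd (Cmul c x) (Cmul d x).
Proof. Cring. Qed.
Lemma Cmul1 x : Cmul C1 x = x.
Proof. Cring. Qed.
Lemma CmulAl c d x : Cmul (Cmul c d) x = Cmul c (Cmul d x).
Proof. by rewrite CmulA. Qed.

Definition complexCVS : CVS :=
  Build_CVS CaddA CaddC Cadd0 CaddN CmulDr CmulDl CmulAl Cmul1.

Section ProdCVS.
Variables Z W : CVS.
Local Notation T := (Z * W)%type.
Let pzero : T := (vzero Z, vzero W).
Let pplus (x y : T) : T := (vadd x.1 y.1, vadd x.2 y.2).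
Let popp (x : T) : T := (vopp x.1, vopp x.2).
Let pscal c (x : T) : T := (vscal c x.1, vscal c x.2).
Definition prodCVS : CVS.
refine (@Build_CVS T pzero pplus popp pscal _ _ _ _ _ _ _ _);
 rewrite /pzero /pplus /popp /pscal /=.
- by move=> x y z; rewrite !vaddA.
- by move=> x y; congr pair; rewrite vaddC.
- by case=> x y /=; rewrite !vadd0.
- by case=> x y /=; rewrite !vaddN.
- by move=> c x y; rewrite !vscalDr.
- by move=> c d x; rewrite !vscalDl.
- by move=> c d x; rewrite !vscalA.
- by case=> x y /=; rewrite !vscal1.
Defined.
End ProdCVS.

Lemma mx_eq (Z : CVS) m n (A B : mx Z m n) : (forall i j, A i j = B i j) -> A = B.
Proof. by move=> h; apply/funext => i; apply/funext => j. Qed.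

Section MxCVS.
Variables (Z : CVS) (m n : nat).
Definition mxCVS : CVS.
refine (@Build_CVS (mx Z m n) (@mx0 Z m n) (@mxadd Z m n) (@mxopp Z m n) (@mxscal Z m n)
  _ _ _ _ _ _ _ _); rewrite /mx0 /mxadd /mxopp /mxscal.
- by move=> x y z; apply: mx_eq => i j; rewrite vaddA.
- by move=> x y; apply: mx_eq => i j; rewrite vaddC.
- by move=> x; apply: mx_eq => i j; rewrite vadd0.
- by move=> x; apply: mx_eq => i j; rewrite vaddN.
- by move=> c x y; apply: mx_eq => i j; rewrite vscalDr.
- by move=> c d x; apply: mx_eq => i j; rewrite vscalDl.
- by move=> c d x; apply: mx_eq => i j; rewrite vscalA.
- by move=> x; apply: mx_eq => i j; rewrite vscal1.
Defined.
End MxCVS.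

(** * The Hahn-Banach theorem *)

Lemma glb_exists (S : R -> Prop) m :
  (exists x, S x) -> (forall x, S x -> m <= x) ->
  exists l, (forall x, S x -> l <= x) /\ (forall b, (forall x, S x -> b <= x) -> b <= l).
Proof.
move=> [x0 Sx0] hm.
have [||l [hl1 hl2]] := completeness (fun y => S (- y)).
- by exists (- m) => y /hm; lra.
- by exists (- x0); rewrite Ropp_involutive.
exists (- l); split.
  move=> x Sx; have : - x <= l by apply: hl1; rewrite Ropp_involutive.
  lra.
move=> b hb; have : l <= - b by apply: hl2 => y /hb; lra.
lra.
Qed.

Definition rlinear (V : CVS) (f : V -> R) :=
  (forall x y, f (vadd x y) = f x + f y) /\
  (forall t x, f (vscal (RtoC t) x) = t * f x).

Section HahnBanach.
Variable V : CVS.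
Implicit Types (q : V -> R) (x y : V).

(** Homogeneity is only an inequality, which is easier to check for infima; applying it to 1/t gives
    back equality in [sublinear_scal]. *)
Definition sublinear q :=
  (forall x y, q (vadd x y) <= q x + q y) /\
  (forall t x, 0 < t -> q (vscal (RtoC t) x) <= t * q x).

Lemma sublinear0 q : sublinear q -> q (vzero V) = 0.
Proof.
move=> [h1 h2]; have := h1 (vzero V) (vzero V); rewrite vadd0.
have := h2 (1/2) (vzero V); rewrite vscalr0; lra.
Qed.

Lemma sublinear_opp q x : sublinear q -> - q (vopp x) <= q x.
Proof.
by move=> hq; case: (hq) => h1 _; have := h1 x (vopp x); rewrite vaddrN sublinear0 //; lra.
Qed.

Lemma sublinear_scal q t x : sublinear q -> 0 <= t -> q (vscal (RtoC t) x) = t * q x.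
Proof.
move=> hq; case: (hq) => h1 h2 [t0|<-]; last first.
  by rewrite (vscal0 x) sublinear0 //; ring.
apply: Rle_antisym; first exact: h2.
have := h2 (/ t) (vscal (RtoC t) x) (Rinv_0_lt_compat _ t0).
rewrite -vscalA.
have -> : Cmul (RtoC (/ t)) (RtoC t) = C1 by apply: Ceq => /=; field; lra.
rewrite vscal1 => h.
have := Rmult_le_compat_l t _ _ (Rlt_le _ _ t0) h.
by rewrite -Rmult_assoc Rinv_r ?Rmult_1_l //; lra.
Qed.

(* [q'] is the directional infimum x |-> inf_{t >= 0} q (x + t y) - t q y; replacing
   a minimal q by it forces additivity along y. *)
Lemma sublinear_direction q y : sublinear q ->
  exists q', [/\ sublinear q', forall x, q' x <= q x & q' (vopp y) <= - q y].
Proof.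
move=> hq; case: (hq) => hD hZ.
pose S x r := exists t, 0 <= t /\ r = q (vadd x (vscal (RtoC t) y)) - t * q y.
have hex x : exists l, (forall r, S x r -> l <= r) /\
    (forall b, (forall r, S x r -> b <= r) -> b <= l).
  (* The lower bound comes from t q(y) = q(t y) <= q(x + t y) + q(-x). *)
  apply: (@glb_exists _ (- q (vopp x))).
    by eexists; exists 0; split; [lra | reflexivity].
  move=> r [t [t0 ->]].
  have := hD (vadd x (vscal (RtoC t) y)) (vopp x).
  rewrite (vaddC x) vaddKN sublinear_scal //; lra.
have [q' hq'] := choice hex.
have le1 x t : 0 <= t -> q' x <= q (vadd x (vscal (RtoC t) y)) - t * q y.
  by move=> t0; apply: (proj1 (hq' x)); exists t.
have le2 x b : (forall t, 0 <= t -> b <= q (vadd x (vscal (RtoC t) y)) - t * q y) -> b <= q' x.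
  by move=> h; apply: (proj2 (hq' x)) => r [t [t0 ->]]; apply: h.
exists q'; split; last 2 first.
- by move=> x; have := le1 x 0; rewrite (vscal0 y) vaddr0; lra.
- have := le1 (vopp y) 1; rewrite (vscal1 y) vaddN sublinear0 //; lra.
split.
  move=> x z.
  suff : q' (vadd x z) - q' x <= q' z by lra.
  apply: (le2) => s s0.
  suff : q' (vadd x z) - (q (vadd z (vscal (RtoC s) y)) - s * q y) <= q' x by lra.
  apply: (le2) => t t0.
  have := le1 (vadd x z) (t + s).
  have -> : RtoC (t + s) = Cadd (RtoC t) (RtoC s) by Cring.
  rewrite vscalDl vaddACA => h1.
  have := hD (vadd x (vscal (RtoC t) y)) (vadd z (vscal (RtoC s) y)).
  lra.
move=> t x t0.
suff : q' (vscal (RtoC t) x) / t <= q' x.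
  move=> h; have := Rmult_le_compat_l t _ _ (Rlt_le _ _ t0) h.
  by rewrite (_ : t * (q' (vscal (RtoC t) x) / t) = q' (vscal (RtoC t) x)) //; field; lra.
apply: (le2) => s s0.
have := le1 (vscal (RtoC t) x) (t * s).
have -> : RtoC (t * s) = Cmul (RtoC t) (RtoC s) by Cring.
rewrite vscalA -vscalDr (sublinear_scal _ hq); try lra.
move=> h.
apply: (Rmult_le_reg_l t) => //.
rewrite (_ : t * (q' (vscal (RtoC t) x) / t) = q' (vscal (RtoC t) x)); last by field; lra.
have := h; have : 0 <= t * s by nra.
lra.
Qed.

(** Zorn's lemma for the reversed pointwise order. A nonempty chain has its pointwise infimum as
    bound, which is finite because every member is at least -q0(-x) at x. *)
Lemma sublinear_minimal q0 : sublinear q0 ->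
  exists q, [/\ sublinear q, forall x, q x <= q0 x &
    forall q', sublinear q' -> (forall x, q' x <= q x) -> q' = q].
Proof.
move=> h0.
pose T := {q | sublinear q /\ forall x, q x <= q0 x}.
pose Rr : rel T := fun a b => `[< forall x, sval b x <= sval a x >].
have [||||a ha] := @Zorn T Rr.
- by move=> t; apply/asboolP => x; lra.
- by move=> r s t /asboolP h1 /asboolP h2; apply/asboolP => x; have := h1 x; have := h2 x; lra.
- move=> [s ps] [t pt] /asboolP h1 /asboolP h2; apply: eq_exist; apply/funext => x.
  by have := h1 x; have := h2 x; rewrite /=; lra.
- move=> A tot.
  have [[a0 Aa0]|nA] := EM (exists a, A a); last first.
    (* The empty chain is bounded by q0 itself. *)
    exists (exist _ q0 (conj h0 (fun x => Rle_refl _))) => s As.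
    by case: nA; exists s.
  pose S x r := exists2 a, A a & r = sval a x.
  have hex x : exists l, (forall r, S x r -> l <= r) /\
      (forall b, (forall r, S x r -> b <= r) -> b <= l).
    apply: (@glb_exists _ (- q0 (vopp x))).
      by exists (sval a0 x); exists a0.
    move=> r [[a [sa la]] Aa ->] /=.
    by have := sublinear_opp x sa; have := la (vopp x); lra.
  have [q hq] := choice hex.
  have le1 x a : A a -> q x <= sval a x by move=> Aa; apply: (proj1 (hq x)); exists a.
  have le2 x b : (forall a, A a -> b <= sval a x) -> b <= q x.
    by move=> h; apply: (proj2 (hq x)) => r [a Aa ->]; apply: h.
  have sq : sublinear q.
    split.
      move=> x y.
      suff : q (vadd x y) - q x <= q y by lra.
      apply: (le2) => b Ab.
      suff : q (vadd x y) - sval b y <= q x by lra.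
      apply: (le2) => a Aa.
      (* Subadditivity needs one functional at both points; in a chain the smaller of a and b
         serves. *)
      have [/asboolP hab|/asboolP hab] := tot a b Aa Ab.
        have := le1 (vadd x y) b Ab; have := (proj1 (proj1 (svalP b))) x y.
        have := hab x; lra.
      have := le1 (vadd x y) a Aa; have := (proj1 (proj1 (svalP a))) x y.
      have := hab y; lra.
    move=> t x t0.
    suff : q (vscal (RtoC t) x) / t <= q x.
      move=> h; have := Rmult_le_compat_l t _ _ (Rlt_le _ _ t0) h.
      by rewrite (_ : t * (q (vscal (RtoC t) x) / t) = q (vscal (RtoC t) x)) //; field; lra.
    apply: (le2) => a Aa.
    apply: (Rmult_le_reg_l t) => //.
    rewrite (_ : t * (q (vscal (RtoC t) x) / t) = q (vscal (RtoC t) x)); last by field; lra.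
    have := le1 (vscal (RtoC t) x) a Aa; have := (proj2 (proj1 (svalP a))) t x t0; lra.
  have lq x : q x <= q0 x.
    by have := le1 x a0 Aa0; have := proj2 (svalP a0) x; lra.
  by exists (exist _ q (conj sq lq)) => s As; apply/asboolP => x; apply: (le1).
case: a ha => q [sq lq] /= ha; exists q; split => // q' sq' lq'.
have lq0 x : q' x <= q0 x by have := lq' x; have := lq x; lra.
have := ha (exist _ q' (conj sq' lq0)) (asboolT _).
by move=> /(_ lq') [].
Qed.

(** A minimal sublinear functional f is linear: its directional infimum along any x lies below f,
    hence equals f, and this forces f(-x) <= -f(x). Minimising below the directional infimum of q0
    along y, instead of below q0 itself, secures f(-y) <= -q0(y), which is the lower bound at y. *)
Lemma hahn_banach q0 y : sublinear q0 ->
  exists f, [/\ rlinear f, forall x, f x <= q0 x & q0 y <= f y].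
Proof.
move=> h0; have [q1 [h1 l1 e1]] := sublinear_direction y h0.
have [f [hf lf mf]] := sublinear_minimal h1.
have fN x : f (vopp x) = - f x.
  have [g [hg lg eg]] := sublinear_direction x hf.
  have := mf g hg lg => ?; subst g.
  by have := sublinear_opp x hf; lra.
have fD x z : f (vadd x z) = f x + f z.
  have := proj1 hf x z; have := proj1 hf (vadd x z) (vopp z).
  rewrite vaddKN fN; lra.
exists f; split.
- split => // t x; case: (Rle_lt_dec 0 t) => t0; first exact: sublinear_scal.
  rewrite -[vscal _ x]voppK fN.
  rewrite (_ : vopp (vscal (RtoC t) x) = vscal (RtoC (- t)) x).
    by rewrite sublinear_scal //; [ring | lra].
  by rewrite voppE -vscalA; congr vscal; Cring.
- by move=> x; have := lf x; have := l1 x; lra.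
- by have := lf (vopp y); rewrite fN; lra.
Qed.

(** Hahn-Banach is applied to the order-unit gauge q(x) = inf { t : t e - x in G }. Elements x of G
    have q(-x) <= 0, so any linear functional below q is nonnegative on G; q(e) <= 1, and the last
    hypothesis says c <= q(W). *)
Lemma order_unit_separation (G : V -> Prop) (e W : V) c :
  G (vzero V) ->
  (forall x y, G x -> G y -> G (vadd x y)) ->
  (forall t x, 0 < t -> G x -> G (vscal (RtoC t) x)) ->
  (forall x, exists t, G (vadd (vscal (RtoC t) e) (vopp x))) ->
  (forall r, G (vscal (RtoC r) e) -> 0 <= r) ->
  (forall t, G (vadd (vscal (RtoC t) e) (vopp W)) -> c <= t) ->
  exists f, [/\ rlinear f, forall x, G x -> 0 <= f x, f e <= 1 & c <= f W].
Proof.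
move=> G0 GD GZ Gu Ge Gc.
pose S x t := G (vadd (vscal (RtoC t) e) (vopp x)).
have SD x y s t : S x s -> S y t -> S (vadd x y) (s + t).
  move=> h1 h2; have := GD _ _ h1 h2.
  rewrite vaddACA -vscalDl -voppD /S.
  by rewrite (_ : RtoC (s + t) = Cadd (RtoC s) (RtoC t)) //; Cring.
have hex x : exists l, (forall r, S x r -> l <= r) /\
    (forall b, (forall r, S x r -> b <= r) -> b <= l).
  (* With s e + x in G fixed, each t e - x in G gives (t + s) e in G, hence t >= -s. *)
  have [s hs] := Gu (vopp x).
  apply: (@glb_exists _ (- s)); first exact: Gu.
  move=> t ht; suff : 0 <= t + s by lra.
  apply: Ge; have := SD _ _ _ _ ht hs.
  by rewrite /S vaddrN vopp0 vaddr0.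
have [q hq] := choice hex.
have le1 x t : S x t -> q x <= t by apply: (proj1 (hq x)).
have le2 x b : (forall t, S x t -> b <= t) -> b <= q x by apply: (proj2 (hq x)).
have sq : sublinear q.
  split.
    move=> x y.
    suff : q (vadd x y) - q x <= q y by lra.
    apply: (le2) => s hs.
    suff : q (vadd x y) - s <= q x by lra.
    apply: (le2) => t ht.
    have := le1 _ _ (SD _ _ _ _ ht hs); lra.
  move=> t x t0.
  suff : q (vscal (RtoC t) x) / t <= q x.
    move=> h; have := Rmult_le_compat_l t _ _ (Rlt_le _ _ t0) h.
    by rewrite (_ : t * (q (vscal (RtoC t) x) / t) = q (vscal (RtoC t) x)) //; field; lra.
  apply: (le2) => s hs.
  apply: (Rmult_le_reg_l t) => //.
  rewrite (_ : t * (q (vscal (RtoC t) x) / t) = q (vscal (RtoC t) x)); last by field; lra.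
  apply: (le1); have := GZ t _ t0 hs; rewrite vscalDr -vscalA vscalN /S.
  by rewrite (_ : Cmul (RtoC t) (RtoC s) = RtoC (t * s)) //; Cring.
have [f [lf hf fW]] := hahn_banach W sq.
exists f; split => //.
- move=> x Gx.
  have : q (vopp x) <= 0 by apply: (le1); rewrite /S (vscal0 e) vadd0 voppK.
  have := hf (vopp x); rewrite voppE (proj2 lf); lra.
- have := hf e; have : q e <= 1 by apply: (le1); rewrite /S (vscal1 e) vaddrN.
  lra.
- by have := le2 _ _ Gc; lra.
Qed.

End HahnBanach.

(** * Completion of a semi-inner product space *)

(* No module axioms are required of the carrier: null vectors and failures of the
   axioms disappear in the completion, whose points are functionals. *)
Record preinner := {
  pcar :> Type;
  pbase : pcar;
  padd : pcar -> pcar -> pcar;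
  pscal : C -> pcar -> pcar;
  pform : pcar -> pcar -> C;
  pformDl : forall x y z, pform (padd x y) z = Cadd (pform x z) (pform y z);
  pformZl : forall c x y, pform (pscal c x) y = Cmul c (pform x y);
  pformC : forall x y, pform y x = Cconj (pform x y);
  pform_ge0 : forall x, 0 <= re (pform x x)
}.

Section PreInner.
Variable E : preinner.
Implicit Types x y z u v : E.

Lemma pformDr x y z : pform x (padd y z) = Cadd (pform x y) (pform x z).
Proof. by rewrite pformC pformDl (pformC x y) (pformC x z); Cring. Qed.

Lemma pformZr c x y : pform x (pscal c y) = Cmul (Cconj c) (pform x y).
Proof. by rewrite pformC pformZl (pformC x y); Cring. Qed.

Lemma pform_im x : im (pform x x) = 0.
Proof. by have := f_equal im (pformC x x) => /=; lra. Qed.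

Definition pnorm x := sqrt (re (pform x x)).

Lemma pnorm_ge0 x : 0 <= pnorm x.
Proof. exact: sqrt_pos. Qed.

Lemma pnorm_sq x : pnorm x * pnorm x = re (pform x x).
Proof. by rewrite /pnorm sqrt_sqrt //; apply: pform_ge0. Qed.

Lemma pnormZ c x : pnorm (pscal c x) = Cmod c * pnorm x.
Proof.
rewrite /pnorm /Cmod pformZl pformZr -sqrt_mult; last 2 first.
- nra.
- exact: pform_ge0.
by congr sqrt; rewrite /= pform_im; ring.
Qed.

Lemma pform_quad u c x :
  re (pform (padd u (pscal c x)) (padd u (pscal c x))) =
  re (pform u u) + 2 * re (Cmul (Cconj c) (pform u x)) + Csq c * re (pform x x).
Proof.
rewrite !pformDl !pformDr !pformZl !pformZr (pformC u x) /Csq /= pform_im; ring.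
Qed.

(** Take s = 1/p, or s large when p = 0. The factor D in both terms is what results from perturbing
    a vector by s d x with |d|^2 = D, so the same lemma serves Cauchy-Schwarz, near-minimizers and
    both polarization arguments. *)
Lemma discriminant_bound D p a : 0 <= D -> 0 <= p ->
  (forall s, 2 * s * D - s * s * D * p <= a) -> D <= a * p.
Proof.
move=> D0 p0 h.
have a0 : 0 <= a by have := h 0; lra.
case: (Req_dec p 0) => [?|p1]; first subst p.
  case: (Req_dec D 0) => [?|D1]; first lra.
  (* This s turns the hypothesis into a + 1 <= a. *)
  have := h ((a + 1) / (2 * D)).
  have -> : 2 * ((a + 1) / (2 * D)) * D = a + 1 by field; lra.
  lra.
have := h (/ p).
have -> : 2 * / p * D - / p * / p * D * p = D / p by field; lra.
move=> h1; have := Rmult_le_compat_r p _ _ p0 h1.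
by rewrite (_ : D / p * p = D) //; field; lra.
Qed.

Lemma cauchy_schwarz x y : Cmod (pform x y) <= pnorm x * pnorm y.
Proof.
have hx := pnorm_ge0 x; have hy := pnorm_ge0 y.
apply: Cmod_le; first nra.
have -> : pnorm x * pnorm y * (pnorm x * pnorm y) =
  (pnorm x * pnorm x) * (pnorm y * pnorm y) by ring.
rewrite !pnorm_sq.
apply: discriminant_bound; [exact: Csq_ge0 | exact: pform_ge0 |] => s.
set d := pform x y.
have := pform_ge0 (padd x (pscal (Cmul (RtoC (- s)) d) y)).
rewrite pform_quad -/d /Csq /=; nra.
Qed.

Definition psub x y := padd x (pscal (RtoC (-1)) y).

Lemma pform_subl x y z : pform (psub x y) z = Csub (pform x z) (pform y z).
Proof. by rewrite pformDl pformZl; Cring. Qed.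

End PreInner.

(** * Bounded antilinear functionals and their approximate representatives *)

Section Functionals.
Variable E : preinner.
Implicit Types x y u v : E.

(** Antilinear, because forms are linear in their first argument: then u |-> <u, .> embeds linearly,
    without conjugating scalars. *)
Record afun := {
  afv :> E -> C;
  afD : forall x y, afv (padd x y) = Cadd (afv x) (afv y);
  afZ : forall c x, afv (pscal c x) = Cmul (Cconj c) (afv x);
  afB : exists M, 0 <= M /\ forall x, Cmod (afv x) <= M * pnorm x
}.

Definition afbound (f : E -> C) M := 0 <= M /\ forall x, Cmod (f x) <= M * pnorm x.

Lemma afun_eq (f g : afun) : (forall x, f x = g x) -> f = g.
Proof.
case: f g => f fD fZ fB [g gD gZ gB] /= h.
have ? : f = g by apply/funext.
by subst g; congr Build_afun; apply: Prop_irrelevance.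
Qed.

Lemma afB0 : exists M, afbound (fun=> C0) M.
Proof. by exists 0; split=> [|x]; rewrite ?Cmod0; lra. Qed.

Definition afzero : afun.
refine (@Build_afun (fun=> C0) _ _ afB0); [by move=> *; Cring | by move=> *; Cring].
Defined.

Lemma afBD (f g : afun) : exists M, afbound (fun x => Cadd (f x) (g x)) M.
Proof.
have [M [M0 hM]] := afB f; have [N [N0 hN]] := afB g.
exists (M + N); split; first lra.
move=> x; have := CmodD (f x) (g x); have := hM x; have := hN x; lra.
Qed.

Definition afadd (f g : afun) : afun.
refine (@Build_afun (fun x => Cadd (f x) (g x)) _ _ (afBD f g)).
  by move=> x y; rewrite !afD; Cring.
by move=> c x; rewrite !afZ; Cring.
Defined.

Lemma afBZ (c : C) (f : afun) : exists M, afbound (fun x => Cmul c (f x)) M.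
Proof.
have [M [M0 hM]] := afB f; have c0 := Cmod_ge0 c.
exists (Cmod c * M); split; first nra.
move=> x; rewrite CmodM; have := hM x; nra.
Qed.

Definition afscal (c : C) (f : afun) : afun.
refine (@Build_afun (fun x => Cmul c (f x)) _ _ (afBZ c f)).
  by move=> x y; rewrite !afD; Cring.
by move=> d x; rewrite !afZ; Cring.
Defined.

(** The opposite is scaling by -1, so that [psub] is convertible to the subtraction occurring in the
    completeness field of [Hilbert]. *)
Definition afunCVS : CVS.
refine (@Build_CVS afun afzero afadd (afscal (RtoC (-1))) afscal _ _ _ _ _ _ _ _);
  by move=> *; apply: afun_eq => ?; Cring.
Defined.

Definition afemb u : afun.
refine (@Build_afun (fun x => pform u x) _ _ _).
- by move=> x y; rewrite pformDr.
- by move=> c x; rewrite pformZr.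
- exists (pnorm u); split; [exact: pnorm_ge0 | exact: cauchy_schwarz].
Defined.

(** The functionals f and <u, .> are at distance at most e in the dual norm. *)
Definition approx (f : E -> C) e u :=
  0 <= e /\ forall x, Cmod (Csub (f x) (pform u x)) <= e * pnorm x.

(* A near-minimizer u of |u|^2 - 2 Re f(u) represents f approximately. *)
Lemma approx_exists (f : afun) e : 0 < e -> exists u, approx f e u.
Proof.
move=> e0.
pose J u := re (pform u u) - 2 * re (f u).
have [M [M0 hM]] := afB f.
have [||m [m1 m2]] := @glb_exists (fun r => exists u, r = J u) (- (M * M)).
- by exists (J (pbase E)); exists (pbase E).
- move=> r [u ->]; rewrite /J -pnorm_sq.
  have := hM u; have := re_le (f u).
  have := Rle_0_sqr (pnorm u - M); rewrite /Rsqr; nra.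
(* The slack e^2 is the constant a of [discriminant_bound]: with d = f(x) - <u, x>, the bound J(u +
   s d x) >= m reads 2 s |d|^2 - s^2 |d|^2 |x|^2 <= e^2. *)
have [u hu] : exists u, J u < m + e * e.
  apply/not_existsP => h.
  have : m + e * e <= m.
    by apply: m2 => r [u ->]; have := h u; lra.
  nra.
exists u; split=> [|x]; first lra.
have x0 := pnorm_ge0 x.
set d := Csub (f x) (pform u x).
apply: Cmod_le; first nra.
have -> : e * pnorm x * (e * pnorm x) = (e * e) * (pnorm x * pnorm x) by ring.
rewrite pnorm_sq.
apply: discriminant_bound; [exact: Csq_ge0 | exact: pform_ge0 |] => s.
have hm : m <= J (padd u (pscal (Cmul (RtoC s) d) x)) by apply: m1; eexists.
move: hm; rewrite /J pform_quad afD afZ => hm.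
move: hu hm; rewrite /J /d /Csq /=; nra.
Qed.

Lemma approxD (f g : afun) e d u v :
  approx f e u -> approx g d v -> approx (afadd f g) (e + d) (padd u v).
Proof.
move=> [e0 hu] [d0 hv]; split=> [|x]; first lra.
rewrite pformDl /=.
by have := CsubD (f x) (g x) (pform u x) (pform v x); have := hu x; have := hv x; lra.
Qed.

Lemma approxZ c (f : afun) e u :
  approx f e u -> approx (afscal c f) (Cmod c * e) (pscal c u).
Proof.
move=> [e0 hu]; split=> [|x]; first by have := Cmod_ge0 c; nra.
rewrite pformZl.
have -> : Csub (afscal c f x) (Cmul c (pform u x)) = Cmul c (Csub (f x) (pform u x)) by Cring.
rewrite CmodM; have := hu x; have := Cmod_ge0 c; nra.
Qed.

(** Testing f at u itself gives |u|^2 <= (M + e) |u|. *)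
Lemma approx_norm (f : E -> C) M e u : afbound f M -> approx f e u -> pnorm u <= M + e.
Proof.
move=> [M0 hM] [e0 hu].
have u0 := pnorm_ge0 u.
have : pnorm u * pnorm u <= (M + e) * pnorm u.
  have h1 := hM u; have h2 := hu u.
  have h3 := re_le (f u); have h4 := Nre_le (Csub (f u) (pform u u)).
  rewrite re_Csub in h4; rewrite pnorm_sq; lra.
move=> h; case: (Rle_lt_dec (pnorm u) (M + e)) => // h'.
have : 0 < pnorm u by lra.
nra.
Qed.

(** Testing both approximations at w = u - v gives |w|^2 <= (e + d) |w|. Hence the approximate
    representatives of a functional form a Cauchy net with an explicit rate. *)
Lemma approx_dist (f : E -> C) e d u v : approx f e u -> approx f d v ->
  pnorm (psub u v) <= e + d.
Proof.
move=> [e0 hu] [d0 hv]; set w := psub u v; have w0 := pnorm_ge0 w.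
have : pnorm w * pnorm w <= (e + d) * pnorm w.
  rewrite pnorm_sq {1}/w pform_subl -/w.
  apply: Rle_trans (re_le _) _.
  have := Csub_tri (f w) (pform u w) (pform v w).
  rewrite (CsubC (pform u w) (f w)); have := hu w; have := hv w; lra.
move=> h; case: (Rle_lt_dec (pnorm w) (e + d)) => // h'.
have : 0 < pnorm w by lra.
nra.
Qed.

Lemma afun_sub (f : afun) u v : f (psub u v) = Csub (f u) (f v).
Proof. by rewrite afD afZ; Cring. Qed.

End Functionals.

(* The net is presented by its rate of convergence: A u e means that u is e-close
   to the limit. *)
Lemma cauchy_limit_real (T : Type) (A : T -> R -> Prop) (r : T -> R) M :
  (exists u e, A u e) ->
  (forall u e v d, A u e -> A v d -> Rabs (r u - r v) <= M * (e + d)) ->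
  exists l, forall u e, A u e -> Rabs (l - r u) <= M * e.
Proof.
move=> [u0 [e0 A0]] h.
(* The limit is the supremum of the lower bounds r u - M e; the Cauchy estimate makes every r v + M
   d an upper bound for them. *)
have [||l [l1 l2]] := completeness (fun x => exists u e, A u e /\ x = r u - M * e).
- exists (r u0 + M * e0) => x [u [e [hu ->]]].
  have := h _ _ _ _ hu A0; have := Rle_abs (r u - r u0); lra.
- by eexists; exists u0, e0.
exists l => u e hu.
have h1 : r u - M * e <= l by apply: l1; exists u, e.
have h2 : l <= r u + M * e.
  apply: l2 => x [v [d [hv ->]]].
  have := h _ _ _ _ hv hu; have := Rle_abs (r v - r u); lra.
by apply: Rabs_le; lra.
Qed.

(** The factor 2 is the cost of treating real and imaginary parts separately. *)
Lemma cauchy_limit (T : Type) (A : T -> R -> Prop) (r : T -> C) M :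
  (exists u e, A u e) ->
  (forall u e v d, A u e -> A v d -> Cmod (Csub (r u) (r v)) <= M * (e + d)) ->
  exists l, forall u e, A u e -> Cmod (Csub l (r u)) <= 2 * M * e.
Proof.
move=> hA h.
have [|a ha] := @cauchy_limit_real T A (fun u => re (r u)) M hA.
  move=> u e v d hu hv; apply: Rle_trans (h _ _ _ _ hu hv).
  exact: (re_le_Cmod (Csub (r u) (r v))).
have [|b hb] := @cauchy_limit_real T A (fun u => im (r u)) M hA.
  move=> u e v d hu hv; apply: Rle_trans (h _ _ _ _ hu hv).
  exact: (im_le_Cmod (Csub (r u) (r v))).
exists (mkC a b) => u e hu.
apply: Rle_trans (Cmod_le_reim _) _.
have := ha _ _ hu; have := hb _ _ hu; rewrite /= /Rminus; lra.
Qed.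

(** * Inner product and completeness of the space of functionals *)

Section Completion.
Variable E : preinner.
Implicit Types (x y u v : E) (f g : afun E).

(** For f = <u, .> the pairing with g must be conj (g u); in general it is the limit of these
    numbers along the approximate representatives of f. *)
Lemma afinner_exists f g : exists c, exists2 M, 0 <= M &
  forall e u, approx f e u -> Cmod (Csub c (Cconj (g u))) <= M * e.
Proof.
have [M [M0 hM]] := afB g.
have [||c hc] := @cauchy_limit _ (fun u e => approx f e u) (fun u => Cconj (g u)) M.
- by have [u hu] := @approx_exists E f 1 Rlt_0_1; exists u, 1.
- move=> u e v d hu hv.
  have -> : Csub (Cconj (g u)) (Cconj (g v)) = Cconj (g (psub u v)).
    by rewrite afun_sub; Cring.
  rewrite Cmod_conj.
  have := approx_dist hu hv; have := hM (psub u v); nra.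
by exists c, (2 * M) => [|e u]; [lra | exact: hc].
Qed.

Definition afinner f g : C := sval (cid (afinner_exists f g)).

Lemma afinner_spec f g : exists2 M, 0 <= M &
  forall e u, approx f e u -> Cmod (Csub (afinner f g) (Cconj (g u))) <= M * e.
Proof. exact: (svalP (cid (afinner_exists f g))). Qed.

Lemma afinnerD f f' g : afinner (afadd f f') g = Cadd (afinner f g) (afinner f' g).
Proof.
have [M M0 hM] := afinner_spec (afadd f f') g.
have [N N0 hN] := afinner_spec f g; have [N' N'0 hN'] := afinner_spec f' g.
apply: (@Ceq_eps _ _ (2 * M + N + N')) => e e0 _.
have [u hu] := approx_exists f e0; have [v hv] := approx_exists f' e0.
have h1 := hM _ _ (approxD hu hv); have h2 := hN _ _ hu; have h3 := hN' _ _ hv.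
have h4 := CsubD (afinner f g) (afinner f' g) (Cconj (g u)) (Cconj (g v)).
have h5 := Csub_tri (Cconj (g (padd u v))) (afinner (afadd f f') g)
  (Cadd (afinner f g) (afinner f' g)).
have E1 : Cadd (Cconj (g u)) (Cconj (g v)) = Cconj (g (padd u v)) by rewrite afD; Cring.
rewrite CsubC E1 in h4; lra.
Qed.

Lemma afinnerZ c f g : afinner (afscal c f) g = Cmul c (afinner f g).
Proof.
have [M M0 hM] := afinner_spec (afscal c f) g.
have [N N0 hN] := afinner_spec f g.
have c0 := Cmod_ge0 c.
apply: (@Ceq_eps _ _ (M * Cmod c + N * Cmod c)) => e e0 _.
have [u hu] := approx_exists f e0.
have h1 := hM _ _ (approxZ c hu); have h2 := hN _ _ hu.
have := Csub_tri (Cconj (g (pscal c u))) (afinner (afscal c f) g) (Cmul c (afinner f g)).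
have -> : Csub (Cconj (g (pscal c u))) (Cmul c (afinner f g))
  = Cmul (Copp c) (Csub (afinner f g) (Cconj (g u))) by rewrite afZ; Cring.
rewrite CmodM Cmod_opp; nra.
Qed.

(* For near-representatives u of f and v of g, conj (f v) and g u both approximate <v, u>. *)
Lemma afinnerC f g : afinner g f = Cconj (afinner f g).
Proof.
have [M M0 hM] := afinner_spec g f; have [N N0 hN] := afinner_spec f g.
have [K hK] := afB f; have [L hL] := afB g.
apply: (@Ceq_eps _ _ (M + N + (K + 1) + (L + 1))) => e e0 e1.
have [u hu] := approx_exists f e0; have [v hv] := approx_exists g e0.
have ku := approx_norm hK hu.
have lv := approx_norm hL hv.
have h1 := hM _ _ hv; have h2 := hN _ _ hu; have h3 := (proj2 hu) v; have h4 := (proj2 hv) u.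
have := Csub_tri (Cconj (f v)) (afinner g f) (Cconj (afinner f g)).
have := Csub_tri (pform v u) (Cconj (f v)) (Cconj (afinner f g)).
have := Csub_tri (g u) (pform v u) (Cconj (afinner f g)).
have -> : Csub (Cconj (f v)) (pform v u) = Cconj (Csub (f v) (pform u v)).
  by rewrite (pformC u v); Cring.
have -> : Csub (g u) (Cconj (afinner f g)) = Copp (Cconj (Csub (afinner f g) (Cconj (g u)))).
  by Cring.
rewrite Cmod_opp !Cmod_conj (CsubC (pform v u) (g u)).
nra.
Qed.

Lemma afinner_ge0 f : 0 <= re (afinner f f).
Proof.
have [M M0 hM] := afinner_spec f f; have [K hK] := afB f.
suff : - re (afinner f f) <= 0 by lra.
apply: (@le_eps _ (M + K + 1)) => e e0 e1.
have [u hu] := approx_exists f e0.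
have ku := approx_norm hK hu.
have h1 := hM _ _ hu; have h2 := (proj2 hu) u; have h3 := pform_ge0 u.
have h4 := Nre_le (Csub (afinner f f) (Cconj (f u))).
have h5 := Nre_le (Csub (f u) (pform u u)).
rewrite !re_Csub re_conj in h4 h5; nra.
Qed.

(** Packaging the functionals as a [preinner] makes Cauchy-Schwarz available on them before
    definiteness and completeness are known. *)
Definition afpre : preinner :=
  @Build_preinner (afun E) (afzero E) (@afadd E) (@afscal E) afinner
    afinnerD afinnerZ afinnerC afinner_ge0.

Lemma reproducing f x : afinner f (afemb x) = f x.
Proof.
have [M M0 hM] := afinner_spec f (afemb x).
have x0 := pnorm_ge0 x.
apply: (@Ceq_eps _ _ (M + pnorm x)) => e e0 e1.
have [u hu] := approx_exists f e0.
have := hM _ _ hu; have := (proj2 hu) x.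
have := Csub_tri (pform u x) (afinner f (afemb x)) (f x).
rewrite (CsubC (pform u x) (f x)) /= -(pformC x u); lra.
Qed.

(** If u represents f up to e, then <f, f> is close to conj (f u), and |f u| <= M |u| <= M (M +
    e). *)
Lemma afnorm_le f M : afbound f M -> pnorm (f : afpre) <= M.
Proof.
move=> hM; have M0 := proj1 hM.
apply: sqr_le => //; rewrite pnorm_sq.
have [N N0 hN] := afinner_spec f f.
suff : re (afinner f f) - M * M <= 0 by rewrite /=; lra.
apply: (@le_eps _ (N + M)) => e e0 e1.
have [u hu] := approx_exists f e0.
have ku := approx_norm hM hu.
have h1 := hN _ _ hu; have h2 := (proj2 hM) u.
have h3 := re_le (Csub (afinner f f) (Cconj (f u))); have h4 := re_le (f u).
rewrite re_Csub re_conj in h3; nra.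
Qed.

Lemma afemb_norm x : pnorm (afemb x : afpre) = pnorm x.
Proof. by rewrite /pnorm /= reproducing. Qed.

Lemma af_le_norm f x : Cmod (f x) <= pnorm (f : afpre) * pnorm x.
Proof.
by have := cauchy_schwarz (f : afpre) (afemb x); rewrite /= reproducing afemb_norm.
Qed.

Lemma afinner_eq0 f : afinner f f = C0 -> f = afzero E.
Proof.
move=> h; apply: afun_eq => x; apply: Cmod_eq0.
apply: Rle_trans (af_le_norm f x) _.
by rewrite /pnorm /= h /= sqrt_0; lra.
Qed.

(** Evaluation at x is bounded by |x|, so a Cauchy sequence converges pointwise with an error
    proportional to |x|. This uniformity makes the limit a bounded functional and gives convergence
    in norm. *)
Lemma af_complete (s : nat -> afun E) :
  (forall eps, eps > 0 -> exists N, forall m n, (N <= m)%N -> (N <= n)%N ->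
     pnorm (psub (s m : afpre) (s n)) < eps) ->
  exists l, forall eps, eps > 0 -> exists N, forall n, (N <= n)%N ->
     pnorm (psub (s n : afpre) l) < eps.
Proof.
move=> hs.
(* [A k e] records that s k is within e of all later terms, which is the rate required by
   [cauchy_limit]. *)
pose A k e := 0 < e /\ forall m, (k <= m)%N -> pnorm (psub (s m : afpre) (s k)) <= e.
have hA e : e > 0 -> exists k, A k e.
  by move=> e0; have [N hN] := hs _ e0; exists N; split => // m hm; apply: Rlt_le; apply: hN.
have dist k e m d x : A k e -> A m d -> Cmod (Csub (s k x) (s m x)) <= pnorm x * (e + d).
  move=> [e0 hk] [d0 hm]; have x0 := pnorm_ge0 x.
  have := hk _ (leq_maxl k m); have := hm _ (leq_maxr k m).
  set p := maxn k m => h1 h2.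
  have := Csub_tri (s p x) (s k x) (s m x).
  rewrite (CsubC (s k x) (s p x)).
  have E1 (j : nat) : Csub (s p x) (s j x) = (psub (s p : afpre) (s j) : afun E) x by Cring.
  rewrite !E1.
  have := af_le_norm (psub (s p : afpre) (s k)) x.
  have := af_le_norm (psub (s p : afpre) (s m)) x; nra.
have hl x : exists c, forall k e, A k e -> Cmod (Csub c (s k x)) <= 2 * pnorm x * e.
  apply: cauchy_limit => [|k e m d hk hm]; last exact: dist.
  by have [k hk] := hA 1 Rlt_0_1; exists k, 1.
have [l hl'] := choice hl.
have lD x y : l (padd x y) = Cadd (l x) (l y).
  apply: (@Ceq_eps _ _ (2 * pnorm (padd x y) + 2 * pnorm x + 2 * pnorm y)) => e e0 _.
  have [k hk] := hA e e0.
  have := Csub_tri (s k (padd x y)) (l (padd x y)) (Cadd (l x) (l y)).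
  have := hl' (padd x y) _ _ hk; have := hl' x _ _ hk; have := hl' y _ _ hk.
  rewrite afD (CsubC (Cadd (s k x) _) (Cadd (l x) (l y))).
  have := CsubD (l x) (l y) (s k x) (s k y); lra.
have lZ c x : l (pscal c x) = Cmul (Cconj c) (l x).
  have c0 := Cmod_ge0 c.
  apply: (@Ceq_eps _ _ (2 * pnorm (pscal c x) + Cmod c * (2 * pnorm x))) => e e0 _.
  have [k hk] := hA e e0.
  have := Csub_tri (s k (pscal c x)) (l (pscal c x)) (Cmul (Cconj c) (l x)).
  have := hl' (pscal c x) _ _ hk; have := hl' x _ _ hk.
  rewrite afZ.
  have -> : Csub (Cmul (Cconj c) (s k x)) (Cmul (Cconj c) (l x))
     = Copp (Cmul (Cconj c) (Csub (l x) (s k x))) by Cring.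
  rewrite Cmod_opp CmodM Cmod_conj; nra.
have lB : exists M, 0 <= M /\ forall x, Cmod (l x) <= M * pnorm x.
  have [k hk] := hA 1 Rlt_0_1; have [M [M0 hM]] := afB (s k).
  exists (M + 2); split=> [|x]; first lra.
  have := hl' x _ _ hk; have := hM x.
  have := CmodD (Csub (l x) (s k x)) (s k x).
  have -> : Cadd (Csub (l x) (s k x)) (s k x) = l x by Cring.
  lra.
exists (Build_afun lD lZ lB) => eps eps0.
(* The distance to the limit is at most 3 (eps / 5): one part from the Cauchy tail, two from the
   pointwise limit. *)
have e0 : eps / 5 > 0 by lra.
have [k hk] := hA _ e0; exists k => n hn.
suff : pnorm (psub (s n : afpre) (Build_afun lD lZ lB)) <= 3 * (eps / 5) by lra.
apply: afnorm_le; split; first lra.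
move=> x.
have -> : (psub (s n : afpre) (Build_afun lD lZ lB) : afun E) x = Csub (s n x) (l x) by Cring.
have := Csub_tri (s k x) (s n x) (l x).
rewrite (CsubC (s k x) (l x)).
have := hl' x _ _ hk.
have -> : Csub (s n x) (s k x) = (psub (s n : afpre) (s k) : afun E) x by Cring.
have := af_le_norm (psub (s n : afpre) (s k)) x.
have := (proj2 hk) n hn; have := pnorm_ge0 x; nra.
Qed.

Definition completion : Hilbert.
refine (@Build_Hilbert (afunCVS E) afinner afinnerD afinnerZ afinnerC afinner_ge0
  afinner_eq0 af_complete).
Defined.

End Completion.

(** * Operators defined by bounded sesquilinear forms *)

Lemma Csum_morph (f : C -> C) (I : Type) (r : seq I) (P : pred I) (F : I -> C) :
  (forall a b, f (Cadd a b) = Cadd (f a) (f b)) -> f C0 = C0 ->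
  f (\big[Cadd/C0]_(i <- r | P i) F i) = \big[Cadd/C0]_(i <- r | P i) f (F i).
Proof. by move=> h1 h0; apply: (big_morph f h1 h0). Qed.

Lemma Csum_mul c (I : Type) (r : seq I) (F : I -> C) :
  Cmul c (\big[Cadd/C0]_(i <- r) F i) = \big[Cadd/C0]_(i <- r) Cmul c (F i).
Proof. by apply: Csum_morph; [move=> *; Cring | Cring]. Qed.

Lemma Csum_conj (I : Type) (r : seq I) (F : I -> C) :
  Cconj (\big[Cadd/C0]_(i <- r) F i) = \big[Cadd/C0]_(i <- r) Cconj (F i).
Proof. by apply: Csum_morph; [move=> *; Cring | Cring]. Qed.

Lemma re_sum (I : Type) (r : seq I) (F : I -> C) :
  re (\big[Cadd/C0]_(i <- r) F i) = \big[Rplus/0]_(i <- r) re (F i).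
Proof. exact: (big_morph re). Qed.

Lemma Rsum_le (I : Type) (r : seq I) (F G : I -> R) :
  (forall i, F i <= G i) ->
  \big[Rplus/0]_(i <- r) F i <= \big[Rplus/0]_(i <- r) G i.
Proof. by move=> h; elim/big_ind2: _ => *; lra || exact: h. Qed.

Lemma Rsum_ge0 (I : Type) (r : seq I) (F : I -> R) :
  (forall i, 0 <= F i) -> 0 <= \big[Rplus/0]_(i <- r) F i.
Proof. by move=> h; elim/big_ind: _ => *; lra || exact: h. Qed.

Lemma Rsum_mul c (I : Type) (r : seq I) (F : I -> R) :
  c * (\big[Rplus/0]_(i <- r) F i) = \big[Rplus/0]_(i <- r) (c * F i).
Proof. exact: (big_morph (fun x => c * x) (Rmult_plus_distr_l c) (Rmult_0_r c)). Qed.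

(** * Quadratic forms and real parts of operator matrices on H^n *)

Section InnerN.
Variable H : Hilbert.

Lemma innerDr (x y z : H) : inner x (vadd y z) = Cadd (inner x y) (inner x z).
Proof. by rewrite innerC innerDl (innerC x y) (innerC x z); Cring. Qed.

Lemma innerZr c (x y : H) : inner x (vscal c y) = Cmul (Cconj c) (inner x y).
Proof. by rewrite innerC innerZl (innerC x y); Cring. Qed.

Lemma inner0l (x : H) : inner (vzero H) x = C0.
Proof. by rewrite -(vscal0 (vzero H)) innerZl; Cring. Qed.

Lemma inner_suml (I : Type) (r : seq I) (F : I -> H) y :
  inner (\big[@vadd H/vzero H]_(i <- r) F i) y = \big[Cadd/C0]_(i <- r) inner (F i) y.
Proof.
apply: (big_morph (fun x => inner x y)) => [? ?|]; [exact: innerDl | exact: inner0l].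
Qed.

Variable n : nat.
Implicit Types x y : 'I_n -> H.

Definition addN x y : 'I_n -> H := fun i => vadd (x i) (y i).
Definition scalN c x : 'I_n -> H := fun i => vscal c (x i).

Lemma innerN_Dl x y z : innerN (addN x y) z = Cadd (innerN x z) (innerN y z).
Proof. by rewrite /innerN -big_split; apply: eq_bigr => i _; apply: innerDl. Qed.

Lemma innerN_Zl c x y : innerN (scalN c x) y = Cmul c (innerN x y).
Proof. by rewrite /innerN Csum_mul; apply: eq_bigr => i _; apply: innerZl. Qed.

Lemma innerN_C x y : innerN y x = Cconj (innerN x y).
Proof. by rewrite /innerN Csum_conj; apply: eq_bigr => i _; apply: innerC. Qed.

Lemma innerN_ge0 x : 0 <= re (innerN x x).
Proof. by rewrite /innerN re_sum; apply: Rsum_ge0 => i; apply: inner_ge0. Qed.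

Definition powpre : preinner :=
  @Build_preinner ('I_n -> H) (fun=> vzero H) addN scalN (@innerN H n)
    innerN_Dl innerN_Zl innerN_C innerN_ge0.

Definition qform (T : 'I_n -> 'I_n -> Bop H) x y : C :=
  \big[Cadd/C0]_(i < n) \big[Cadd/C0]_(j < n) inner (T i j (x j)) (y i).

Variable T : 'I_n -> 'I_n -> Bop H.

Lemma inner_badj (S : Bop H) (x y : H) : inner (badj S x) y = Cconj (inner (S y) x).
Proof. by rewrite bop_adj innerC. Qed.

Lemma innerN_ReM x y : innerN (opmx (ReM T) x) y =
  Cmul (RtoC (1/2)) (Cadd (qform T x y) (Cconj (qform T y x))).
Proof.
rewrite /innerN /opmx /ReM.
under eq_bigr => i _ do rewrite inner_suml.
have -> : Cconj (qform T y x) =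
  \big[Cadd/C0]_(i < n) \big[Cadd/C0]_(j < n) inner (badj (T j i) (x j)) (y i).
  rewrite /qform Csum_conj exchange_big /=; apply: eq_bigr => i _.
  rewrite Csum_conj; apply: eq_bigr => j _; by rewrite inner_badj.
rewrite /qform -big_split Csum_mul; apply: eq_bigr => i _.
rewrite -big_split Csum_mul; apply: eq_bigr => j _.
by rewrite innerZl innerDl.
Qed.

Lemma positive_ReM : positive_op (ReM T) <-> forall x, 0 <= re (qform T x x).
Proof.
split=> h x; have := h x; rewrite innerN_ReM /=; [case=> _; lra | move=> ?; split; lra].
Qed.

Lemma qform_add x x' y y' : qform T (addN x x') (addN y y') =
  Cadd (Cadd (qform T x y) (qform T x y')) (Cadd (qform T x' y) (qform T x' y')).
Proof.
rewrite /qform -!big_split; apply: eq_bigr => i _; rewrite -!big_split.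
by apply: eq_bigr => j _; rewrite bop_add innerDl !innerDr.
Qed.

Lemma qform_Zl c x y : qform T (scalN c x) y = Cmul c (qform T x y).
Proof.
rewrite /qform Csum_mul; apply: eq_bigr => i _; rewrite Csum_mul.
by apply: eq_bigr => j _; rewrite bop_scal innerZl.
Qed.

Lemma qform_Zr c x y : qform T x (scalN c y) = Cmul (Cconj c) (qform T x y).
Proof.
rewrite /qform Csum_mul; apply: eq_bigr => i _; rewrite Csum_mul.
by apply: eq_bigr => j _; rewrite innerZr.
Qed.

Lemma scalN1 x : scalN C1 x = x.
Proof. by apply/funext => i; apply: vscal1. Qed.

(* Polarization bounds the self-adjoint operator by its numerical radius. *)
Lemma normN_ReM_le c : 0 <= c ->
  (forall x, Rabs (re (qform T x x)) <= c * re (innerN x x)) ->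
  forall x, normN (opmx (ReM T) x) <= c * normN x.
Proof.
move=> c0 hc x; set w := opmx (ReM T) x.
have [x0 w0] := (@pnorm_ge0 powpre x, @pnorm_ge0 powpre w).
apply: sqr_le; first exact: Rmult_le_pos.
have -> : c * normN x * (c * normN x) = (c * (normN x * normN x)) * c by ring.
rewrite (@pnorm_sq powpre w) (@pnorm_sq powpre x).
apply: discriminant_bound => [|//|s]; first exact: innerN_ge0.
(* For this y the cross term <Re(T) x, y> is s |w|^2. Adding the bounds at x + y and x - y gives 4 s
   |w|^2 <= 2 c (|x|^2 + s^2 |w|^2), the hypothesis of [discriminant_bound] with p = c. *)
pose y := scalN (RtoC s) w.
have hp := hc (addN x y); have hm := hc (addN x (scalN (RtoC (-1)) y)).
have p1 := @pform_quad powpre x C1 y; have p2 := @pform_quad powpre x (RtoC (-1)) y.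
rewrite /= scalN1 in p1; rewrite /= in p2.
rewrite p1 in hp; rewrite p2 in hm; rewrite {p1 p2}.
have yy : re (innerN y y) = s * s * re (innerN w w).
  by rewrite innerN_Zl innerN_C innerN_Zl /= (@pform_im powpre w); ring.
have xy : s * re (innerN w w) = (re (qform T x y) + re (qform T y x)) / 2.
  have := f_equal re (innerN_ReM x y); rewrite -/w innerN_C innerN_Zl /=.
  by have := @pform_im powpre w => /= ->; lra.
have qp : re (qform T (addN x y) (addN x y)) = re (qform T x x) + re (qform T y y)
    + 2 * (s * re (innerN w w)) by rewrite qform_add xy /=; lra.
have qm : re (qform T (addN x (scalN (RtoC (-1)) y)) (addN x (scalN (RtoC (-1)) y)))
    = re (qform T x x) + re (qform T y y) - 2 * (s * re (innerN w w)).
  rewrite xy qform_add !qform_Zl !qform_Zr /=; lra.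
rewrite qp in hp; rewrite qm in hm; move: hp hm; rewrite yy /Csq /=.
move=> /(Rle_trans _ _ _ (Rle_abs _)) hp.
rewrite -Rabs_Ropp => /(Rle_trans _ _ _ (Rle_abs _)) hm.
nra.
Qed.

Lemma qform_le_normN x : Rabs (re (qform T x x)) <= normN (opmx (ReM T) x) * normN x.
Proof.
have <- : re (innerN (opmx (ReM T) x) x) = re (qform T x x).
  by rewrite innerN_ReM /=; lra.
apply: Rle_trans (re_le_Cmod _) _.
exact: (@cauchy_schwarz powpre).
Qed.

End InnerN.

(** * The operator of a bounded form, and inequalities that pass to the completion *)

Section Operators.
Variable E : preinner.
Implicit Types (x y u v : E) (f g : afun E).

Lemma afinnerDr f g g' : afinner f (afadd g g') = Cadd (afinner f g) (afinner f g').
Proof. exact: (@pformDr (afpre E)). Qed.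

Lemma afinnerZr c f g : afinner f (afscal c g) = Cmul (Cconj c) (afinner f g).
Proof. exact: (@pformZr (afpre E)). Qed.

Record bform := {
  bf :> E -> E -> C;
  bfDl : forall x y z, bf (padd x y) z = Cadd (bf x z) (bf y z);
  bfZl : forall c x y, bf (pscal c x) y = Cmul c (bf x y);
  bfDr : forall x y z, bf x (padd y z) = Cadd (bf x y) (bf x z);
  bfZr : forall c x y, bf x (pscal c y) = Cmul (Cconj c) (bf x y);
  bfB : exists M, 0 <= M /\ forall x y, Cmod (bf x y) <= M * (pnorm x * pnorm y)
}.

Definition bform_adj (F : bform) : bform.
refine (@Build_bform (fun x y => Cconj (F y x)) _ _ _ _ _).
- by move=> x y z; rewrite bfDr; Cring.
- by move=> c x y; rewrite bfZr; Cring.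
- by move=> x y z; rewrite bfDl; Cring.
- by move=> c x y; rewrite bfZl; Cring.
- have [M [M0 hM]] := bfB F; exists M; split => // x y.
  by rewrite Cmod_conj (Rmult_comm (pnorm x)).
Defined.

(** The vector r of the completion with <u, r> = F u y for every embedded u. *)
Definition bform_row (F : bform) y : afun E.
refine (@Build_afun E (fun x => Cconj (F x y)) _ _ _).
- by move=> x z; rewrite bfDl; Cring.
- by move=> c x; rewrite bfZl; Cring.
- have [M [M0 hM]] := bfB F; exists (M * pnorm y).
  split; first by have := pnorm_ge0 y; nra.
  by move=> x; rewrite Cmod_conj Rmult_assoc (Rmult_comm (pnorm y)).
Defined.

Lemma bform_row_norm F M : (forall x y, Cmod (bf F x y) <= M * (pnorm x * pnorm y)) ->
  0 <= M -> forall y, pnorm (bform_row F y : afpre E) <= M * pnorm y.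
Proof.
move=> hM M0 y; apply: afnorm_le; split; first by have := pnorm_ge0 y; nra.
by move=> x; rewrite /= Cmod_conj Rmult_assoc (Rmult_comm (pnorm y)).
Qed.

Lemma form_op_bound F M f : (forall x y, Cmod (bf F x y) <= M * (pnorm x * pnorm y)) ->
  0 <= M -> afbound (fun y => afinner f (bform_row F y)) (M * pnorm (f : afpre E)).
Proof.
move=> hM M0; have f0 := @pnorm_ge0 (afpre E) f; split; first nra.
move=> y; have := @cauchy_schwarz (afpre E) f (bform_row F y) => /=.
have := bform_row_norm hM M0 y; nra.
Qed.

(** Pairing f with the rows of F defines the operator at once on the whole completion; no extension
    by density is involved. *)
Definition form_op (F : bform) f : afun E.
refine (@Build_afun E (fun y => afinner f (bform_row F y)) _ _ _).
- move=> x y; rewrite -afinnerDr; congr afinner.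
  by apply: afun_eq => z /=; rewrite bfDr; Cring.
- move=> c x; rewrite -afinnerZr; congr afinner.
  by apply: afun_eq => z /=; rewrite bfZr; Cring.
- have [M [M0 hM]] := bfB F; exists (M * pnorm (f : afpre E)); exact: form_op_bound.
Defined.

Lemma form_op_norm F M f : (forall x y, Cmod (bf F x y) <= M * (pnorm x * pnorm y)) ->
  0 <= M -> pnorm (form_op F f : afpre E) <= M * pnorm (f : afpre E).
Proof. by move=> hM M0; apply/afnorm_le/form_op_bound. Qed.

Lemma form_opD F f g : form_op F (afadd f g) = afadd (form_op F f) (form_op F g).
Proof. by apply: afun_eq => y /=; rewrite afinnerD. Qed.

Lemma form_opZ F c f : form_op F (afscal c f) = afscal c (form_op F f).
Proof. by apply: afun_eq => y /=; rewrite afinnerZ. Qed.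

Lemma form_op_emb F u : form_op F (afemb u) = bform_row (bform_adj F) u.
Proof.
by apply: afun_eq => y /=; rewrite afinnerC reproducing.
Qed.

Lemma afnorm_sub_emb f e u : approx f e u -> pnorm (psub (f : afpre E) (afemb u)) <= e.
Proof.
move=> [e0 hu]; apply: afnorm_le; split => // x.
have -> : (psub (f : afpre E) (afemb u) : afun E) x = Csub (f x) (pform u x) by Cring.
exact: hu.
Qed.

(** For g an embedded vector the identity is the reproducing property; both sides are continuous in
    g, and g is within e of an embedded vector. *)
Lemma form_op_adj F f g : afinner (form_op F f) g = afinner f (form_op (bform_adj F) g).
Proof.
have [M [M0 hM]] := bfB F; have [M' [M'0 hM']] := bfB (bform_adj F).
have a0 := @pnorm_ge0 (afpre E) f; have b0 := @pnorm_ge0 (afpre E) (form_op F f).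
apply: (@Ceq_eps _ _ (pnorm (form_op F f : afpre E) + pnorm (f : afpre E) * M')) => e e0 _.
have [v hv] := approx_exists g e0.
have hd := afnorm_sub_emb hv.
set d := psub (g : afpre E) (afemb v) in hd.
have E1 : afinner (form_op F f) (afemb v) = afinner f (form_op (bform_adj F) (afemb v)).
  rewrite reproducing form_op_emb /=; congr afinner.
  by apply: afun_eq => x /=; Cring.
have g_split : g = afadd (afemb v) d by apply: afun_eq => x; Cring.
have -> : Csub (afinner (form_op F f) g) (afinner f (form_op (bform_adj F) g))
  = Csub (afinner (form_op F f) d) (afinner f (form_op (bform_adj F) d)).
  rewrite {1 2}g_split form_opD !afinnerDr E1.
  Cring.
have h1 := @cauchy_schwarz (afpre E) (form_op F f) d.
have h2 := @cauchy_schwarz (afpre E) f (form_op (bform_adj F) d).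
have h3 := form_op_norm d hM' M'0.
have := CmodD (afinner (form_op F f) d) (Copp (afinner f (form_op (bform_adj F) d))).
rewrite Cmod_opp -/(Csub _ _) => h4.
have k1 := Rmult_le_compat_l _ _ _ b0 hd.
have k2 := Rmult_le_compat_l _ _ _ a0 h3.
have k3 := Rmult_le_compat_l _ _ _ M'0 hd.
have k4 := Rmult_le_compat_l _ _ _ a0 k3.
by move: h1 h2 k1 k2 k3 k4 h4; rewrite /=; lra.
Qed.

Definition form_bop (F : bform) : Bop (completion E).
refine (@Build_Bop (completion E) (form_op F) (form_op (bform_adj F))
  (form_opD F) (form_opZ F) _ (form_op_adj F)).
have [M [M0 hM]] := bfB F; exists M => f; exact: form_op_norm.
Defined.

Lemma form_op_inner_emb F u v : afinner (form_op F (afemb u)) (afemb v) = F u v.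
Proof. by rewrite reproducing form_op_emb /=; Cring. Qed.

(** Writing f = u + d and g = v + d', the error is <T d, g> + <T u, d'>. The summand 1 in the
    constant comes from |u| <= |f| + e with e <= 1. *)
Lemma form_op_inner_approx F f g : exists2 K, 0 <= K & forall e u v, e <= 1 ->
  approx f e u -> approx g e v -> Cmod (Csub (afinner (form_op F f) g) (F u v)) <= K * e.
Proof.
have [M [M0 hM]] := bfB F.
have f0 := @pnorm_ge0 (afpre E) f; have g0 := @pnorm_ge0 (afpre E) g.
exists (M * (pnorm (g : afpre E) + pnorm (f : afpre E) + 1)); first nra.
move=> e u v e1 hu hv.
have hdu := afnorm_sub_emb hu; have hdv := afnorm_sub_emb hv.
have uf : pnorm u <= pnorm (f : afpre E) + e.
  by apply: (@approx_norm _ f) => //; split => // x; apply: af_le_norm.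
rewrite -form_op_inner_emb.
set d := psub (f : afpre E) (afemb u) in hdu; set d' := psub (g : afpre E) (afemb v) in hdv.
have f_split : f = afadd (afemb u) d by apply: afun_eq => x; Cring.
have g_split : g = afadd (afemb v) d' by apply: afun_eq => x; Cring.
have -> : Csub (afinner (form_op F f) g) (afinner (form_op F (afemb u)) (afemb v)) =
  Cadd (afinner (form_op F d) g) (afinner (form_op F (afemb u)) d').
  rewrite {1}f_split form_opD afinnerD {1}g_split !afinnerDr.
  by rewrite g_split afinnerDr; Cring.
have h1 := @cauchy_schwarz (afpre E) (form_op F d) g.
have h2 := @cauchy_schwarz (afpre E) (form_op F (afemb u)) d'.
have h3 := form_op_norm d hM M0; have h4 := form_op_norm (afemb u) hM M0.
rewrite afemb_norm in h4.
apply: Rle_trans (CmodD _ _) _.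
have [e0 _] := hu.
have k1 : Cmod (afinner (form_op F d) g) <= M * e * pnorm (g : afpre E).
  by apply: Rle_trans h1 _; apply: Rmult_le_compat_r => //; nra.
have k2 : Cmod (afinner (form_op F (afemb u)) d') <= M * (pnorm (f : afpre E) + 1) * e.
  apply: Rle_trans h2 _; apply: Rmult_le_compat => //; try exact: pnorm_ge0.
  nra.
lra.
Qed.

(** Each f i is replaced by one representative u i, used in both slots of every term, so that the
    hypothesis applies to u; the finitely many errors add up to a multiple of e. *)
Lemma form_ineq_completion n (G : 'I_n -> 'I_n -> bform) :
  (forall x : 'I_n -> E,
     0 <= re (\big[Cadd/C0]_(i < n) \big[Cadd/C0]_(j < n) G i j (x j) (x i))) ->
  forall f : 'I_n -> afun E,
    0 <= re (\big[Cadd/C0]_(i < n) \big[Cadd/C0]_(j < n) afinner (form_op (G i j) (f j)) (f i)).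
Proof.
move=> hG f.
have hK (p : 'I_n * 'I_n) : exists K, forall e u v, e <= 1 ->
  approx (f p.2) e u -> approx (f p.1) e v ->
  Cmod (Csub (afinner (form_op (G p.1 p.2) (f p.2)) (f p.1)) (G p.1 p.2 u v)) <= K * e.
  by have [K _ h] := form_op_inner_approx (G p.1 p.2) (f p.2) (f p.1); exists K.
have [K {}hK] := choice hK.
suff : - re (\big[Cadd/C0]_(i < n) \big[Cadd/C0]_(j < n)
   afinner (form_op (G i j) (f j)) (f i)) <= 0 by lra.
apply: (@le_eps _ (\big[Rplus/0]_(i < n) \big[Rplus/0]_(j < n) K (i, j))) => e e0 e1.
have hu i : exists u, approx (f i) e u by apply: approx_exists.
have [u {}hu] := choice hu.
have := hG u; rewrite !re_sum.
under eq_bigr => i _ do rewrite re_sum.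
under [in X in _ -> X]eq_bigr => i _ do rewrite re_sum.
have : \big[Rplus/0]_(i < n) \big[Rplus/0]_(j < n) re (G i j (u j) (u i)) <=
  \big[Rplus/0]_(i < n) \big[Rplus/0]_(j < n)
    (re (afinner (form_op (G i j) (f j)) (f i)) + e * K (i, j)).
  apply: Rsum_le => i; apply: Rsum_le => j.
  have /= := hK (i, j) e (u j) (u i) e1 (hu j) (hu i).
  have := Nre_le (Csub (afinner (form_op (G i j) (f j)) (f i)) (G i j (u j) (u i))).
  rewrite re_Csub; lra.
under [X in _ <= X]eq_bigr => i _ do rewrite big_split /= -Rsum_mul.
rewrite big_split /= -Rsum_mul; lra.
Qed.

End Operators.

(** * The matrix cone on Z x C *)

Definition cmx1 n : cmx n n := fun i j => if i == j then C1 else C0.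
Arguments cmx1 : clear implicits.

Section Congruence.
Variable Z : CVS.

Lemma vsum_scal (I : Type) (r : seq I) (F : I -> C) (x : Z) :
  vscal (\big[Cadd/C0]_(i <- r) F i) x = \big[@vadd Z/vzero Z]_(i <- r) vscal (F i) x.
Proof.
by apply: (big_morph (fun c => vscal c x)) => [? ?|]; [exact: vscalDl | exact: vscal0].
Qed.

Lemma congr_mxD n k (X : cmx n k) (A B : mx Z n n) :
  congr_mx X (mxadd A B) = mxadd (congr_mx X A) (congr_mx X B).
Proof.
apply: mx_eq => a b; rewrite /congr_mx /mxadd -big_split; apply: eq_bigr => i _.
by rewrite -big_split; apply: eq_bigr => j _; rewrite vscalDr.
Qed.

Lemma congr_mxZ n k (X : cmx n k) c (A : mx Z n n) :
  congr_mx X (mxscal c A) = mxscal c (congr_mx X A).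
Proof.
apply: mx_eq => a b; rewrite /congr_mx /mxscal vscal_sum; apply: eq_bigr => i _.
by rewrite vscal_sum; apply: eq_bigr => j _; rewrite -!vscalA; congr vscal; Cring.
Qed.

Lemma congr_mx0 n k (X : cmx n k) : congr_mx X (@mx0 Z n n) = @mx0 Z k k.
Proof.
by apply: mx_eq => a b; rewrite /congr_mx big1 // => i _; rewrite big1 // => j _; rewrite vscalr0.
Qed.

Definition cmx_scal n k c (X : cmx n k) : cmx n k := fun i j => Cmul c (X i j).

Lemma congr_cmx_scal n k c (X : cmx n k) (A : mx Z n n) :
  congr_mx (cmx_scal c X) A = mxscal (RtoC (Csq c)) (congr_mx X A).
Proof.
apply: mx_eq => a b; rewrite /congr_mx /mxscal vscal_sum; apply: eq_bigr => i _.
rewrite vscal_sum; apply: eq_bigr => j _; rewrite -vscalA; congr vscal.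
by rewrite /cmx_scal /Csq; Cring.
Qed.

Definition cmx_mul m n k (X : cmx m n) (Y : cmx n k) : cmx m k :=
  fun i b => \big[Cadd/C0]_(j < n) Cmul (X i j) (Y j b).

Lemma congr_mx_comp m n k (X : cmx m n) (Y : cmx n k) (A : mx Z m m) :
  congr_mx Y (congr_mx X A) = congr_mx (cmx_mul X Y) A.
Proof.
apply: mx_eq => a b; rewrite /congr_mx.
transitivity (\big[@vadd Z/vzero Z]_(i < n) \big[@vadd Z/vzero Z]_(j < n)
  \big[@vadd Z/vzero Z]_(p < m) \big[@vadd Z/vzero Z]_(q < m)
   vscal (Cmul (Cconj (Cmul (X p i) (Y i a))) (Cmul (X q j) (Y j b))) (A p q)).
  apply: eq_bigr => i _; apply: eq_bigr => j _.
  rewrite vscal_sum; apply: eq_bigr => p _; rewrite vscal_sum; apply: eq_bigr => q _.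
  by rewrite -vscalA; congr vscal; Cring.
under eq_bigr => i _ do rewrite exchange_big /=.
rewrite exchange_big /=; apply: eq_bigr => p _.
under eq_bigr => i _ do rewrite exchange_big /=.
rewrite exchange_big /=; apply: eq_bigr => q _.
rewrite /cmx_mul Csum_conj.
have -> : Cmul (\big[Cadd/C0]_(j < n) Cconj (Cmul (X p j) (Y j a)))
    (\big[Cadd/C0]_(j < n) Cmul (X q j) (Y j b)) =
  \big[Cadd/C0]_(i < n) \big[Cadd/C0]_(j < n)
    Cmul (Cconj (Cmul (X p i) (Y i a))) (Cmul (X q j) (Y j b)).
  under [RHS]eq_bigr => i _ do rewrite -Csum_mul.
  set s := (X in Cmul _ X = _).
  have e c : Cmul c s = Cmul s c by Cring.
  by rewrite e Csum_mul; apply: eq_bigr => i _; rewrite e.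
by rewrite vsum_scal; apply: eq_bigr => i _; rewrite vsum_scal.
Qed.

Definition cmx_col n m k (X : cmx n k) (Y : cmx m k) : cmx (n + m) k :=
  fun i => match split i with inl i' => X i' | inr i' => Y i' end.

Lemma split_lshift m n (i : 'I_m) : split (lshift n i) = inl i.
Proof. exact: (unsplitK (inl i)). Qed.

Lemma split_rshift m n (i : 'I_n) : split (rshift m i) = inr i.
Proof. exact: (unsplitK (inr i)). Qed.

(** Stacking X over Y merges two congruences into one; this is what closes the cones G_n under
    addition. *)
Lemma congr_mx_col n m k (X : cmx n k) (Y : cmx m k) (A : mx Z n n) (B : mx Z m m) :
  congr_mx (cmx_col X Y) (dsum A B) = mxadd (congr_mx X A) (congr_mx Y B).
Proof.
apply: mx_eq => a b; rewrite /congr_mx /mxadd big_split_ord /cmx_col /dsum.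
congr vadd; apply: eq_bigr => i _; rewrite big_split_ord /=.
  rewrite [X in vadd _ X]big1 => [|j _]; last first.
    by rewrite split_lshift split_rshift vscalr0.
  by rewrite vaddr0; apply: eq_bigr => j _; rewrite !split_lshift.
rewrite [X in vadd X _]big1 => [|j _]; last first.
  by rewrite split_lshift split_rshift vscalr0.
by rewrite vadd0; apply: eq_bigr => j _; rewrite !split_rshift.
Qed.

Lemma congr_mx1 n (A : mx Z n n) : congr_mx (cmx1 n) A = A.
Proof.
apply: mx_eq => a b; rewrite /congr_mx (bigD1 a) //= [X in vadd _ X]big1 => [|i ia].
  rewrite vaddr0 (bigD1 b) //= [X in vadd _ X]big1 => [|j jb].
    rewrite vaddr0 /cmx1 !eqxx -[RHS]vscal1; congr vscal; Cring.
  by rewrite /cmx1 (negbTE jb) -(vscal0 (A a j)); congr vscal; Cring.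
rewrite big1 // => j _; rewrite /cmx1 (negbTE ia) -(vscal0 (A i j)); congr vscal; Cring.
Qed.

End Congruence.

(** * Scalar matrices whose quadratic form has nonnegative real part *)

Definition scalar_mx n c : mx complexCVS n n := fun i j => if i == j then c else C0.
Arguments scalar_mx : clear implicits.

(** Only the real part is constrained and S need not be hermitian: purely imaginary scalar matrices
    are [psd] with both signs. *)
Definition psd n (S : mx complexCVS n n) :=
  forall v : cmx n 1, 0 <= re (congr_mx v S ord0 ord0).

Definition sqnorm n (v : cmx n 1) := \big[Rplus/0]_(i < n) Csq (v i ord0).

Lemma sqnorm_ge0 n (v : cmx n 1) : 0 <= sqnorm v.
Proof. by apply: Rsum_ge0 => i; apply: Csq_ge0. Qed.

Lemma congr_scalar_mx n (v : cmx n 1) c :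
  congr_mx v (scalar_mx n c) ord0 ord0 = Cmul c (RtoC (sqnorm v)).
Proof.
have -> : Cmul c (RtoC (sqnorm v)) = \big[Cadd/C0]_(i < n) Cmul c (RtoC (Csq (v i ord0))).
  have RtoCD : {morph RtoC : a b / a + b >-> Cadd a b} by move=> a b; Cring.
  by rewrite -Csum_mul /sqnorm (big_morph RtoC RtoCD (erefl C0)).
apply: eq_bigr => i _; rewrite (bigD1 i) //= big1 => [|j ji].
  by rewrite /scalar_mx eqxx /Csq; Cring.
by rewrite /scalar_mx eq_sym (negbTE ji); Cring.
Qed.

Lemma psdD n (S T : mx complexCVS n n) : psd S -> psd T -> psd (mxadd S T).
Proof. by move=> hS hT v; rewrite congr_mxD /=; have := hS v; have := hT v; lra. Qed.

Lemma psdZ n t (S : mx complexCVS n n) : 0 <= t -> psd S -> psd (mxscal (RtoC t) S).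
Proof. by move=> t0 hS v; rewrite congr_mxZ /=; have := hS v; nra. Qed.

Lemma psd_congr n k (X : cmx n k) (S : mx complexCVS n n) : psd S -> psd (congr_mx X S).
Proof. by move=> hS v; rewrite congr_mx_comp. Qed.

Lemma psd_scalar n c : 0 <= re c -> psd (scalar_mx n c).
Proof. by move=> c0 v; rewrite congr_scalar_mx /=; have := sqnorm_ge0 v; nra. Qed.

Lemma psd_scalar_inv n r : psd (scalar_mx n.+1 (RtoC r)) -> 0 <= r.
Proof.
move=> /(_ (fun i _ => if i == ord0 then C1 else C0)); rewrite congr_scalar_mx /sqnorm.
rewrite (bigD1 ord0) //= big1 => [|i i0]; first by rewrite ?eqxx /Csq /=; lra.
by rewrite (negbTE i0) /Csq /=; ring.
Qed.

Lemma psd0 n : psd (@mx0 complexCVS n n).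
Proof. by move=> v; rewrite congr_mx0 /=; lra. Qed.

(** The sum of the moduli of the entries works, since |a| |b| <= (|a|^2 + |b|^2) / 2 <= |v|^2 for
    any two coordinates a, b of v. *)
Lemma psd_order_unit n (S : mx complexCVS n n) :
  exists t, psd (mxadd (scalar_mx n (RtoC t)) (mxopp S)).
Proof.
exists (\big[Rplus/0]_(i < n) \big[Rplus/0]_(j < n) Cmod (S i j)) => v.
rewrite congr_mxD [re _]/=.
rewrite congr_scalar_mx.
set t := \big[Rplus/0]_(i < n) _.
have -> : re (Cmul (RtoC t) (RtoC (sqnorm v))) = sqnorm v * t by rewrite /=; ring.
have le1 i : Csq (v i ord0) <= sqnorm v.
  rewrite /sqnorm (bigD1 i) //= -[X in X <= _]Rplus_0_r.
  apply: Rplus_le_compat_l; elim/big_ind: _ => [|? ? ? ?|j _]; try lra.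
  exact: Csq_ge0.
suff : - (sqnorm v * t) <= re (congr_mx v (mxopp S) ord0 ord0) by lra.
rewrite /t Rsum_mul /congr_mx re_sum.
have -> : - (\big[Rplus/0]_(i < n) (sqnorm v * \big[Rplus/0]_(j < n) Cmod (S i j))) =
  \big[Rplus/0]_(i < n) \big[Rplus/0]_(j < n) (- (sqnorm v * Cmod (S i j))).
  rewrite (big_morph Ropp Ropp_plus_distr Ropp_0); apply: eq_bigr => i _.
  by rewrite Rsum_mul (big_morph Ropp Ropp_plus_distr Ropp_0).
apply: Rsum_le => i; rewrite re_sum; apply: Rsum_le => j.
set a := v i ord0; set b := v j ord0.
have := Nre_le (@vscal complexCVS (Cmul (Cconj a) b) (mxopp S i j)).
rewrite /= CmodM CmodM Cmod_conj Cmod_opp.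
suff : Cmod a * Cmod b * Cmod (S i j) <= sqnorm v * Cmod (S i j) by rewrite /=; lra.
apply: Rmult_le_compat_r; first exact: Cmod_ge0.
have := le1 i; have := le1 j; rewrite -!Cmod_sq -/a -/b.
have := Rle_0_sqr (Cmod a - Cmod b); rewrite /Rsqr; nra.
Qed.

(** * The cones G_n and their order unit *)

Section MatrixCone.
Variables (Z : CVS) (K : forall n, mx Z n n -> Prop) (h : forall n, mx Z n n -> R).
Hypothesis normalZ : normal_accretive_operator_space K h.

Let ZC := prodCVS Z complexCVS.

Lemma KD n (x y : mx Z n n) : K x -> K y -> K (mxadd x y).
Proof. by case: normalZ => [[[hK _] _] _]; case: (hK n) => h1 _; apply: h1. Qed.

Lemma KZ n t (x : mx Z n n) : 0 <= t -> K x -> K (mxscal (RtoC t) x).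
Proof. by case: normalZ => [[[hK _] _] _]; case: (hK n) => _ h1; apply: h1. Qed.

Lemma Kcongr n k (X : cmx n k) (A : mx Z n n) : K A -> K (congr_mx X A).
Proof. by case: normalZ => [[[_ hK] _] _]; apply: hK. Qed.

(** The cone axioms alone allow an empty cone. Properness puts 0 into the cone of size 1, and
    congruence by a zero row carries it to size n. *)
Lemma K_0 n : K (@mx0 Z n n).
Proof.
have k1 : K (@mx0 Z 1 1).
  by case: normalZ => [[_ hp] _]; have [] := (proj2 (hp (@mx0 Z 1 1))) erefl.
by rewrite -(@congr_mx0 Z _ _ (fun (_ : 'I_1) (_ : 'I_n) => C0)); apply: Kcongr.
Qed.

Lemma K_dim0 (x : mx Z 0 0) : K x.
Proof. by rewrite (_ : x = @mx0 Z 0 0); [exact: K_0 | apply: mx_eq => -[]]. Qed.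

Lemma h_ge0 n (x : mx Z n n) : 0 <= h x.
Proof. by case: normalZ => _ [[[hh _] _] _]; apply: hh. Qed.

Lemma h_scal n t (x : mx Z n n) : h (mxscal (RtoC t) x) = Rabs t * h x.
Proof. by case: normalZ => _ [[_ [_ hh]] _]; apply: hh. Qed.

Lemma h_congr n k (X : cmx n k) (A : mx Z n n) r :
  cmx_norm_is X r -> h (congr_mx X A) <= r ^ 2 * h A.
Proof. by case: normalZ => _ [[[_ [_ [_ [hh _]]]] _] _]; apply: hh. Qed.

Lemma h_dsum n m (A : mx Z n n) (B : mx Z m m) : h (dsum A B) = Rmax (h A) (h B).
Proof. by case: normalZ => _ [[[_ [_ [_ [_ hh]]]] _] _]; apply: hh. Qed.

Lemma mx_oppE n (x : mx Z n n) : mxopp x = mxscal (RtoC (-1)) x.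
Proof. by apply: mx_eq => i j; apply: voppE. Qed.

Lemma h_opp n (x : mx Z n n) : h (mxopp x) = h x.
Proof. by rewrite mx_oppE h_scal Rabs_Ropp Rabs_R1; ring. Qed.

Lemma h_0 n : h (@mx0 Z n n) = 0.
Proof.
have -> : @mx0 Z n n = mxscal (RtoC 0) (@mx0 Z n n).
  by apply: mx_eq => i j; rewrite /mxscal vscalr0.
by rewrite h_scal Rabs_R0; ring.
Qed.

Lemma h_dim0 (x : mx Z 0 0) : h x = 0.
Proof. by rewrite (_ : x = @mx0 Z 0 0); [exact: h_0 | apply: mx_eq => -[]]. Qed.

Definition pairmx n (A : mx Z n n) (S : mx complexCVS n n) : mx ZC n n :=
  fun i j => (A i j, S i j).

Lemma pairmxD n (A B : mx Z n n) S T :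
  mxadd (pairmx A S) (pairmx B T) = pairmx (mxadd A B) (mxadd S T).
Proof. by []. Qed.

Lemma pairmxZ n c (A : mx Z n n) S :
  mxscal c (pairmx A S) = pairmx (mxscal c A) (mxscal c S).
Proof. by []. Qed.

Lemma pairmx_congr n k (X : cmx n k) (A : mx Z n n) S :
  congr_mx X (pairmx A S) = pairmx (congr_mx X A) (congr_mx X S).
Proof.
apply: mx_eq => a b; rewrite /pairmx /congr_mx [LHS]surjective_pairing.
congr pair.
  rewrite (big_morph (fun x : ZC => x.1) (id1 := vzero Z) (op1 := @vadd Z)) //.
  apply: eq_bigr => i _.
  by rewrite (big_morph (fun x : ZC => x.1) (id1 := vzero Z) (op1 := @vadd Z)).
rewrite (big_morph (fun x : ZC => x.2) (id1 := vzero complexCVS) (op1 := @vadd complexCVS)) //.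
apply: eq_bigr => i _.
by rewrite (big_morph (fun x : ZC => x.2) (id1 := vzero complexCVS) (op1 := @vadd complexCVS)).
Qed.

Lemma pairmx_surj n (W : mx ZC n n) : exists A S, W = pairmx A S.
Proof.
exists (fun i j => (W i j).1), (fun i j => (W i j).2).
by apply: mx_eq => i j; rewrite /pairmx -surjective_pairing.
Qed.

(** The inner size m is free, so one congruence term is enough: sums are absorbed by direct sums,
    whose gauge is the maximum, and positive factors by X. *)
Definition Gcone n (W : mx ZC n n) : Prop :=
  exists m (X : cmx m n) (A : mx Z m m) (k : mx Z n n) (S : mx complexCVS n n),
    [/\ h A <= 1, K k, psd S &
        W = mxadd (congr_mx X (pairmx A (scalar_mx m C1))) (pairmx k S)].

Definition Gunit n : mx ZC n n := pairmx (@mx0 Z n n) (scalar_mx n C1).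
Arguments Gunit : clear implicits.

Lemma dsum_pairmx n m (A : mx Z n n) (B : mx Z m m) :
  pairmx (dsum A B) (scalar_mx (n + m) C1) =
  dsum (pairmx A (scalar_mx n C1)) (pairmx B (scalar_mx m C1)).
Proof.
apply: mx_eq => i j; rewrite /pairmx /dsum /scalar_mx.
rewrite -(can_eq (@splitK n m) i j).
by case: (split i) => i'; case: (split j) => j' //=.
Qed.

Lemma GconeD n (V W : mx ZC n n) : Gcone V -> Gcone W -> Gcone (mxadd V W).
Proof.
move=> [m [X [A [k [S [hA hk hS ->]]]]]] [m' [Y [B [l [T [hB hl hT ->]]]]]].
exists (m + m')%N, (cmx_col X Y), (dsum A B), (mxadd k l), (mxadd S T); split.
- by rewrite h_dsum; apply: Rmax_lub.
- exact: KD.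
- exact: psdD.
- rewrite dsum_pairmx congr_mx_col -pairmxD.
  by apply: mx_eq => i j; rewrite /mxadd vaddACA.
Qed.

Lemma GconeZ n t (W : mx ZC n n) : 0 < t -> Gcone W -> Gcone (mxscal (RtoC t) W).
Proof.
move=> t0 [m [X [A [k [S [hA hk hS ->]]]]]].
exists m, (cmx_scal (RtoC (sqrt t)) X), A, (mxscal (RtoC t) k), (mxscal (RtoC t) S); split => //.
- by apply: KZ => //; lra.
- by apply: psdZ => //; lra.
- rewrite congr_cmx_scal.
  have -> : Csq (RtoC (sqrt t)) = t by rewrite /Csq /= sqrt_sqrt; lra.
  by apply: mx_eq => i j; rewrite /mxscal /mxadd vscalDr.
Qed.

Lemma Gcone_congr n k (Y : cmx n k) (W : mx ZC n n) : Gcone W -> Gcone (congr_mx Y W).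
Proof.
move=> [m [X [A [l [S [hA hl hS ->]]]]]].
exists m, (cmx_mul X Y), A, (congr_mx Y l), (congr_mx Y S); split => //.
- exact: Kcongr.
- exact: psd_congr.
- by rewrite congr_mxD congr_mx_comp !pairmx_congr.
Qed.

Lemma Gcone_pair n (k : mx Z n n) S : K k -> psd S -> Gcone (pairmx k S).
Proof.
(* With m = 0 the congruence term vanishes. *)
move=> hk hS; exists 0%N, (fun _ _ => C0), (@mx0 Z 0 0), k, S; split => //.
  by rewrite h_0; lra.
by apply: mx_eq => i j; rewrite /mxadd /congr_mx big_ord0 vadd0.
Qed.

Lemma Gcone_0 n : Gcone (@mx0 ZC n n).
Proof. exact: (Gcone_pair (K_0 n) (@psd0 n)). Qed.

Lemma Gcone_norm n (A : mx Z n n) r : 0 < r -> h A <= r ->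
  Gcone (pairmx A (scalar_mx n (RtoC r))).
Proof.
move=> r0 hA.
(* (A, r) is the congruence of (A / r, 1) by sqrt r times the identity. *)
exists n, (cmx_scal (RtoC (sqrt r)) (cmx1 n)), (mxscal (RtoC (/ r)) A), (@mx0 Z n n),
  (@mx0 complexCVS n n); split.
- rewrite h_scal Rabs_right; last by apply/Rle_ge/Rlt_le/Rinv_0_lt_compat.
  apply: (Rmult_le_reg_l r) => //; rewrite -Rmult_assoc Rinv_r; lra.
- exact: K_0.
- exact: psd0.
- rewrite congr_cmx_scal congr_mx1.
  have -> : Csq (RtoC (sqrt r)) = r by rewrite /Csq /= sqrt_sqrt; lra.
  apply: mx_eq => i j; rewrite /mxadd vaddr0 /mxscal /pairmx /=; congr pair.
    rewrite -vscalA -[LHS]vscal1; congr vscal; apply: Ceq => /=; field; lra.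
  by rewrite /scalar_mx; case: ifP => _; Cring.
Qed.

Lemma Gcone_order_unit n (W : mx ZC n n) :
  exists t, Gcone (mxadd (mxscal (RtoC t) (Gunit n)) (mxopp W)).
Proof.
have [A [S ->]] := pairmx_surj W.
have [t hS] := psd_order_unit S.
have A0 := h_ge0 (mxopp A).
(* The summand 1 keeps the radius positive when h(-A) = 0, as [Gcone_norm] requires. *)
have := GconeD (@Gcone_norm _ (mxopp A) (h (mxopp A) + 1) ltac:(lra) ltac:(lra))
  (Gcone_pair (K_0 n) hS).
rewrite pairmxD => hG; exists (h (mxopp A) + 1 + t); move: hG; congr Gcone.
apply: mx_eq => i j; rewrite /mxadd /pairmx /mxscal /mxopp /Gunit /=; congr pair.
  by rewrite vscalr0 vadd0 vaddr0.
by rewrite /mxadd /mxopp /scalar_mx; case: ifP => _; Cring.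
Qed.

Lemma Gcone_psd n (A : mx Z n n) S : Gcone (pairmx A S) -> psd S.
Proof.
move=> [m [X [B [k [T [_ _ hT hW]]]]]].
have -> : S = mxadd (congr_mx X (scalar_mx m C1)) T.
  apply: mx_eq => i j; have := f_equal (fun W : mx ZC n n => (W i j).2) hW.
  by rewrite pairmx_congr.
have h1 : psd (scalar_mx m C1) by refine (psd_scalar _) => /=; lra.
exact: (psdD (psd_congr X h1) hT).
Qed.

Lemma Gunit_nneg n r : Gcone (mxscal (RtoC r) (Gunit n.+1)) -> 0 <= r.
Proof.
rewrite /Gunit pairmxZ => /Gcone_psd hr; apply: (@psd_scalar_inv n).
suff <- : mxscal (RtoC r) (scalar_mx n.+1 C1) = scalar_mx n.+1 (RtoC r) by [].
by apply: mx_eq => i j; rewrite /mxscal /scalar_mx; case: ifP => _; Cring.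
Qed.

(** * From membership in G_n to the gauge distance from the cone *)

Lemma cvec_norm_sq n (v : 'I_n -> C) :
  cvec_norm v * cvec_norm v = sqnorm (fun i (_ : 'I_1) => v i).
Proof. by rewrite /cvec_norm sqrt_sqrt //; apply: Rsum_ge0 => i; apply: (Csq_ge0 (v i)). Qed.

Lemma cvec_norm_ge0 n (v : 'I_n -> C) : 0 <= cvec_norm v.
Proof. exact: sqrt_pos. Qed.

(** Converts the order inequality X^* X <= t into a norm bound. The gauge axiom refers to the
    operator norm through a least upper bound, so that bound has to be produced together with its
    estimate. *)
Lemma cmx_norm_exists n k (X : cmx n k) t : 0 <= t ->
  (forall v : cmx k 1, sqnorm (cmx_mul X v) <= t * sqnorm v) ->
  exists r, cmx_norm_is X r /\ r ^ 2 <= t.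
Proof.
move=> t0 ht.
have ub s : (exists v, cvec_norm v <= 1 /\ s = cvec_norm (cmx_app X v)) -> s <= sqrt t.
  move=> [v [v1 ->]]; apply: sqr_le; first exact: sqrt_pos.
  rewrite sqrt_sqrt // cvec_norm_sq.
  apply: Rle_trans (ht (fun i _ => v i)) _; rewrite -cvec_norm_sq.
  have v0 := cvec_norm_ge0 v; have : cvec_norm v * cvec_norm v <= 1 by nra.
  by nra.
have [||r hr] := completeness (fun s => exists v, cvec_norm v <= 1 /\
    s = cvec_norm (cmx_app X v)).
- by exists (sqrt t) => s; apply: ub.
- exists (cvec_norm (cmx_app X (fun=> C0))), (fun=> C0); split => //.
  rewrite /cvec_norm big1 => [|i _]; first by rewrite sqrt_0; lra.
  by rewrite /=; ring.
exists r; split => //.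
have r0 : 0 <= r.
  apply: Rle_trans (cvec_norm_ge0 (cmx_app X (fun=> C0))) _.
  apply: (proj1 hr); exists (fun=> C0); split => //.
  rewrite /cvec_norm big1 => [|i _]; first by rewrite sqrt_0; lra.
  by rewrite /=; ring.
have : r <= sqrt t by apply: (proj2 hr) => s; apply: ub.
have := sqrt_sqrt _ t0; have := sqrt_pos t; nra.
Qed.

(** Comparing coordinates of (-z, t) = (X^* A X + k, X^* X + S) gives z + k = -X^* A X and X^* X <=
    t. Hence h(z + k) = h(X^* A X) <= |X|^2 h(A) <= t. *)
Lemma Gcone_dist n (z : mx Z n.+1 n.+1) t :
  Gcone (mxadd (mxscal (RtoC t) (Gunit n.+1)) (mxopp (pairmx z (@mx0 complexCVS n.+1 n.+1)))) ->
  exists2 k, K k & h (mxadd z k) <= t.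
Proof.
move=> hG.
have t0 : 0 <= t.
  have {}hG := GconeD hG (Gcone_0 n.+1).
  have := @Gcone_psd _ (mxopp z) (scalar_mx n.+1 (RtoC t)).
  move=> hp; apply: (@psd_scalar_inv n); apply: hp; move: hG; congr Gcone.
  apply: mx_eq => i j; rewrite /mxadd /mxscal /mxopp /pairmx /Gunit /=; congr pair.
    by rewrite vscalr0 vadd0 vaddr0.
  by rewrite /pairmx /scalar_mx /=; case: ifP => _; Cring.
case: hG => [m [X [A [k [S [hA hk hS hW]]]]]].
rewrite pairmx_congr in hW.
have hz : mxadd z k = mxopp (congr_mx X A).
  apply: mx_eq => i j; have := f_equal (fun W : mx ZC _ _ => (W i j).1) hW.
  rewrite /= /mxadd /mxopp /= vscalr0 vadd0 => e.
  by rewrite -[z i j]voppK e voppD vaddNK.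
exists k => //; rewrite hz h_opp.
have [v|r [hr rt]] := @cmx_norm_exists _ _ X t t0.
  have hS' : S = mxadd (scalar_mx n.+1 (RtoC t)) (mxopp (congr_mx X (scalar_mx m C1))).
    apply: mx_eq => i j; have := f_equal (fun W : mx ZC _ _ => (W i j).2) hW.
    rewrite /= /mxadd /mxopp /= => e.
    have -> : S i j = Cadd (Cadd (congr_mx X (scalar_mx m C1) i j) (S i j))
       (Copp (congr_mx X (scalar_mx m C1) i j)) by Cring.
    by rewrite -e /scalar_mx; case: ifP => _; Cring.
  have := hS v; rewrite hS' congr_mxD [mxadd _ _ _ _]/mxadd.
  have oppE (Q : mx complexCVS n.+1 n.+1) : mxopp Q = mxscal (RtoC (-1)) Q.
    by apply: mx_eq => i j; rewrite /mxopp /mxscal; Cring.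
  rewrite oppE congr_mxZ /mxscal congr_mx_comp !congr_scalar_mx /=; lra.
apply: Rle_trans (h_congr A hr) _.
have := h_ge0 A; have : 0 <= r ^ 2 by nra.
nra.
Qed.

(** [Gcone_dist] makes c a lower bound for the order-unit gauge of (z, 0). The size is positive
    because at size 0 every real multiple of the unit lies in the cone. *)
Lemma Gcone_separation n (z : mx Z n.+1 n.+1) c :
  (forall k, K k -> c <= h (mxadd z k)) ->
  exists f : mx ZC n.+1 n.+1 -> R, [/\ @rlinear (mxCVS ZC n.+1 n.+1) f,
    forall W, Gcone W -> 0 <= f W, f (Gunit n.+1) <= 1 &
    c <= f (pairmx z (@mx0 complexCVS n.+1 n.+1))].
Proof.
move=> hc; apply: (@order_unit_separation (mxCVS ZC n.+1 n.+1) (@Gcone n.+1)).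
- exact: Gcone_0.
- exact: GconeD.
- exact: GconeZ.
- exact: Gcone_order_unit.
- exact: Gunit_nneg.
- by move=> t /Gcone_dist [k hk]; have := hc k hk; lra.
Qed.

End MatrixCone.
Arguments Gunit : clear implicits.

(** * The direct sum of the functionals *)

Section FunctionalForm.
Variables (Z : CVS) (n : nat) (f : mx Z n n -> R).
Hypothesis f_lin : @rlinear (mxCVS Z n n) f.

(** The unique complex-linear functional with real part f. *)
Definition complexify (M : mx Z n n) : C := mkC (f M) (- f (mxscal Ci M)).

Lemma complexifyD M N : complexify (mxadd M N) = Cadd (complexify M) (complexify N).
Proof.
have fD := proj1 f_lin; apply: Ceq => /=; first exact: fD.
have -> : mxscal Ci (mxadd M N) = mxadd (mxscal Ci M) (mxscal Ci N).
  exact: (@vscalDr (mxCVS Z n n)).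
by rewrite (fD (mxscal Ci M)) /=; ring.
Qed.

Lemma f_complex_scal c M : f (mxscal c M) = re c * f M + im c * f (mxscal Ci M).
Proof.
case: f_lin => fD fZ; rewrite -(fZ _ M) -(fZ _ (mxscal Ci M)) -fD; congr f.
apply: mx_eq => i j; rewrite /= /mxadd /mxscal -vscalA -vscalDl; congr vscal; Cring.
Qed.

Lemma complexifyZ c M : complexify (mxscal c M) = Cmul c (complexify M).
Proof.
have e : mxscal Ci (mxscal c M) = mxscal (Cmul Ci c) M.
  by apply: mx_eq => i j; rewrite /mxscal vscalA.
by apply: Ceq; rewrite /= ?e ?(f_complex_scal c) ?(f_complex_scal (Cmul Ci c)) /=; ring.
Qed.

Lemma complexify0 : complexify (@mx0 Z n n) = C0.
Proof.
have -> : @mx0 Z n n = mxscal C0 (@mx0 Z n n).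
  by apply: mx_eq => i j; rewrite /mxscal vscalr0.
by rewrite complexifyZ; Cring.
Qed.

Lemma complexify_sum (I : Type) (r : seq I) (F : I -> mx Z n n) :
  complexify (fun a b => \big[@vadd Z/vzero Z]_(i <- r) F i a b) =
  \big[Cadd/C0]_(i <- r) complexify (F i).
Proof.
rewrite -(big_morph complexify complexifyD complexify0); congr complexify.
apply: mx_eq => a b; symmetry.
exact: (big_morph (fun M : mx Z n n => M a b)).
Qed.

(** The rank-one matrix y^* w x, with x and y read as rows. *)
Definition ranked (w : Z) (x y : 'I_n -> C) : mx Z n n :=
  fun a b => vscal (Cmul (Cconj (y a)) (x b)) w.

Definition functional_form w x y := complexify (ranked w x y).

(** The m vectors x i are the rows of an m by n matrix, and the double sum is the functional at the
    congruence of Y by it. Positivity at size n thereby controls matrix forms of every size m. *)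
Lemma functional_form_sum m (Y : mx Z m m) (x : 'I_m -> 'I_n -> C) :
  \big[Cadd/C0]_(i < m) \big[Cadd/C0]_(j < m) functional_form (Y i j) (x j) (x i) =
  complexify (congr_mx x Y).
Proof.
rewrite /congr_mx complexify_sum; apply: eq_bigr => i _.
by rewrite complexify_sum.
Qed.

Lemma ffDw w w' x y :
  functional_form (vadd w w') x y = Cadd (functional_form w x y) (functional_form w' x y).
Proof.
by rewrite -complexifyD; congr complexify; apply: mx_eq => a b; rewrite /ranked vscalDr.
Qed.

Lemma ffZw c w x y : functional_form (vscal c w) x y = Cmul c (functional_form w x y).
Proof.
rewrite -complexifyZ; congr complexify; apply: mx_eq => a b.
by rewrite /ranked /mxscal -!vscalA; congr vscal; Cring.
Qed.

Lemma ffDl w x x' y : functional_form w (fun a => Cadd (x a) (x' a)) y =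
  Cadd (functional_form w x y) (functional_form w x' y).
Proof.
rewrite -complexifyD; congr complexify; apply: mx_eq => a b.
by rewrite /ranked /mxadd -vscalDl; congr vscal; Cring.
Qed.

Lemma ffZl w c x y : functional_form w (fun a => Cmul c (x a)) y =
  Cmul c (functional_form w x y).
Proof.
rewrite -complexifyZ; congr complexify; apply: mx_eq => a b.
by rewrite /ranked /mxscal -vscalA; congr vscal; Cring.
Qed.

Lemma ffDr w x y y' : functional_form w x (fun a => Cadd (y a) (y' a)) =
  Cadd (functional_form w x y) (functional_form w x y').
Proof.
rewrite -complexifyD; congr complexify; apply: mx_eq => a b.
by rewrite /ranked /mxadd -vscalDl; congr vscal; Cring.
Qed.

Lemma ffZr w c x y : functional_form w x (fun a => Cmul c (y a)) =
  Cmul (Cconj c) (functional_form w x y).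
Proof.
rewrite -complexifyZ; congr complexify; apply: mx_eq => a b.
by rewrite /ranked /mxscal -vscalA; congr vscal; Cring.
Qed.

Lemma ff0l w x y : (forall a, x a = C0) -> functional_form w x y = C0.
Proof.
move=> hx; rewrite -complexify0; congr complexify; apply: mx_eq => a b.
by rewrite /ranked hx /mx0 -(vscal0 w); congr vscal; Cring.
Qed.

End FunctionalForm.

(** * Bounding a sesquilinear form by its diagonal *)

Section Polarization.
Variable E : preinner.
Variable F : E -> E -> C.
Hypothesis FDl : forall x y z, F (padd x y) z = Cadd (F x z) (F y z).
Hypothesis FZl : forall c x y, F (pscal c x) y = Cmul c (F x y).
Hypothesis FDr : forall x y z, F x (padd y z) = Cadd (F x y) (F x z).
Hypothesis FZr : forall c x y, F x (pscal c y) = Cmul (Cconj c) (F x y).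

(** In the polarization identity over the fourth roots of unity the cross terms of the bounds
    cancel, leaving |F x y| <= t (|x|^2 + |y|^2). Replacing x by s x and optimising over s turns the
    sum into the product 2 t |x| |y|. *)
Lemma polarization_bound t : 0 <= t ->
  (forall x, Cmod (F x x) <= t * re (pform x x)) ->
  forall x y, Cmod (F x y) <= 2 * t * (pnorm x * pnorm y).
Proof.
move=> t0 ht.
have h1 x y : Cmod (F x y) <= t * (re (pform x x) + re (pform y y)).
  pose G c := F (padd x (pscal c y)) (padd x (pscal c y)).
  have e : Cmul (RtoC 4) (F x y) = Cadd (Cadd (G C1) (Cmul (RtoC (-1)) (G (RtoC (-1)))))
     (Cadd (Cmul Ci (G Ci)) (Cmul (Copp Ci) (G (Copp Ci)))).
    by rewrite /G !FDl !FDr !FZl !FZr; Cring.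
  have hq c : Csq c = 1 -> Cmod (G c) <= t * (re (pform x x) + re (pform y y)
      + 2 * re (Cmul (Cconj c) (pform x y))).
    move=> c1; apply: Rle_trans (ht _) _; apply: Rmult_le_compat_l => //.
    by rewrite pform_quad c1; lra.
  have m1 : Cmod (RtoC (-1)) = 1 by rewrite Cmod_RtoC Rabs_Ropp Rabs_R1.
  have m2 : Cmod Ci = 1 by rewrite /Cmod /= (_ : 0 * 0 + 1 * 1 = 1) ?sqrt_1 //; ring.
  have := f_equal Cmod e; rewrite CmodM Cmod_RtoC Rabs_right; last lra.
  have := CmodD (Cadd (G C1) (Cmul (RtoC (-1)) (G (RtoC (-1)))))
     (Cadd (Cmul Ci (G Ci)) (Cmul (Copp Ci) (G (Copp Ci)))).
  have := CmodD (G C1) (Cmul (RtoC (-1)) (G (RtoC (-1)))).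
  have := CmodD (Cmul Ci (G Ci)) (Cmul (Copp Ci) (G (Copp Ci))).
  rewrite !CmodM Cmod_opp m1 m2.
  have := hq C1; have := hq (RtoC (-1)); have := hq Ci; have := hq (Copp Ci).
  rewrite /Csq /= => a1 a2 a3 a4.
  move: (a1 ltac:(ring)) (a2 ltac:(ring)) (a3 ltac:(ring)) (a4 ltac:(ring)).
  lra.
move=> x y.
have x0 := pnorm_ge0 x; have y0 := pnorm_ge0 y.
set D := Cmod (F x y); have D0 : 0 <= D by apply: Cmod_ge0.
have [D_0|D1] := Req_dec D 0; first by rewrite D_0; have := Rmult_le_pos _ _ x0 y0; nra.
have xx := pform_ge0 x; have yy := pform_ge0 y.
(* Here p is 2 t |x|^2 / D: the division cancels the factor D in the quadratic term of
   [discriminant_bound]. *)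
have : D <= 2 * t * re (pform y y) * (2 * t * re (pform x x) / D).
  apply: discriminant_bound => // [|s].
    by apply: Rmult_le_pos; [nra | apply/Rlt_le/Rinv_0_lt_compat; lra].
  have -> : 2 * s * D - s * s * D * (2 * t * re (pform x x) / D) =
    2 * (s * D - s * s * t * re (pform x x)) by field.
  have [s0|s0] := Rle_lt_dec 0 s; last first.
    have : s * D <= 0 by nra.
    have : 0 <= s * s * t * re (pform x x) by do 2?apply: Rmult_le_pos => //; nra.
    have : 0 <= t * re (pform y y) by nra.
    lra.
  have := h1 (pscal (RtoC s) x) y.
  rewrite FZl CmodM Cmod_RtoC (Rabs_right s); last lra.
  rewrite -/D pformZl pformZr /=; lra.
move=> hD; apply: sqr_le; first by have := Rmult_le_pos _ _ x0 y0; nra.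
have -> : 2 * t * (pnorm x * pnorm y) * (2 * t * (pnorm x * pnorm y)) =
  2 * t * (pnorm y * pnorm y) * (2 * t * (pnorm x * pnorm x)) by ring.
rewrite !pnorm_sq; have := Rmult_le_compat_r _ _ _ D0 hD.
have -> : 2 * t * re (pform y y) * (2 * t * re (pform x x) / D) * D =
  2 * t * re (pform y y) * (2 * t * re (pform x x)) by field.
by [].
Qed.

End Polarization.

(** * Finitely supported families over all positive functionals, and the map on Z *)

Section DirectSum.
Variables (Z : CVS) (K : forall n, mx Z n n -> Prop) (h : forall n, mx Z n n -> R).
Hypothesis normalZ : normal_accretive_operator_space K h.
Let ZC := prodCVS Z complexCVS.

Record pfun := {
  pf_dim : nat;
  pf_fun : mx ZC pf_dim pf_dim -> R;
  pf_lin : @rlinear (mxCVS ZC pf_dim pf_dim) pf_fun;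
  pf_pos : forall W, Gcone K h W -> 0 <= pf_fun W
}.

HB.instance Definition _ := gen_eqMixin pfun.

(** The list only bounds the true support. Families with equal values and different lists stay
    distinct points, which [preinner] tolerates. *)
Record fam := {
  fam_val :> forall g : pfun, 'I_(pf_dim g) -> C;
  fam_supp : seq pfun;
  fam_out : forall g, g \notin fam_supp -> forall a, @fam_val g a = C0
}.
Arguments fam_val : clear implicits.

Definition pform_at (g : pfun) (w : ZC) (x y : fam) : C :=
  functional_form (@pf_fun g) w (x g) (y g).

(** The support of x alone suffices, as every term vanishes where x does; [fam_formE] allows any
    larger list. *)
Definition fam_form w (x y : fam) : C :=
  \big[Cadd/C0]_(g <- undup (fam_supp x)) pform_at g w x y.

Lemma sum_support (s t : seq pfun) (F : pfun -> C) : uniq t -> {subset s <= t} ->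
  (forall g, g \notin s -> F g = C0) ->
  \big[Cadd/C0]_(g <- undup s) F g = \big[Cadd/C0]_(g <- t) F g.
Proof.
move=> ut st Fs.
rewrite [RHS](bigID (mem s)) /= [X in Cadd _ X]big1 => [|g]; last exact: Fs.
rewrite -[X in Cadd X _]big_filter CaddC Cadd0; apply: perm_big.
apply: uniq_perm; [exact: undup_uniq | exact: filter_uniq |] => g.
by rewrite mem_undup mem_filter; case: (boolP (g \in s)) => // /st ->.
Qed.

Lemma fam_formE t w (x y : fam) : uniq t -> {subset fam_supp x <= t} ->
  fam_form w x y = \big[Cadd/C0]_(g <- t) pform_at g w x y.
Proof.
move=> ut st; apply: sum_support => // g hg.
by apply: ff0l; [exact: pf_lin | exact: fam_out].
Qed.

Definition famD_val (x y : fam) g (a : 'I_(pf_dim g)) : C := Cadd (x g a) (y g a).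

Lemma famD_out x y g : g \notin fam_supp x ++ fam_supp y -> forall a, @famD_val x y g a = C0.
Proof.
rewrite mem_cat negb_or => /andP[hx hy] a.
by rewrite /famD_val !fam_out //; Cring.
Qed.

Definition famD x y := Build_fam (@famD_out x y).

Definition famZ_val c (x : fam) g (a : 'I_(pf_dim g)) : C := Cmul c (x g a).

Lemma famZ_out c x g : g \notin fam_supp x -> forall a, @famZ_val c x g a = C0.
Proof. by move=> hx a; rewrite /famZ_val fam_out //; Cring. Qed.

Definition famZ c x := Build_fam (@famZ_out c x).

Definition fam0 : fam := @Build_fam (fun _ _ => C0) [::] (fun _ _ _ => erefl).

Lemma fam_form_Dl w x y z : fam_form w (famD x y) z = Cadd (fam_form w x z) (fam_form w y z).
Proof.
pose t := undup (fam_supp x ++ fam_supp y).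
have ut : uniq t by apply: undup_uniq.
rewrite !(fam_formE _ _ ut) => [|g|g|g]; rewrite ?mem_undup ?mem_cat; last 3 first.
- by move=> ->; rewrite orbT.
- by move=> ->.
- by [].
by rewrite -big_split; apply: eq_bigr => g _; apply: ffDl; apply: pf_lin.
Qed.

Lemma fam_form_Zl w c x y : fam_form w (famZ c x) y = Cmul c (fam_form w x y).
Proof.
by rewrite /fam_form Csum_mul; apply: eq_bigr => g _; apply: ffZl; apply: pf_lin.
Qed.

Lemma fam_form_Dr w x y z : fam_form w x (famD y z) = Cadd (fam_form w x y) (fam_form w x z).
Proof.
by rewrite /fam_form -big_split; apply: eq_bigr => g _; apply: ffDr; apply: pf_lin.
Qed.

Lemma fam_form_Zr w c x y : fam_form w x (famZ c y) = Cmul (Cconj c) (fam_form w x y).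
Proof.
by rewrite /fam_form Csum_mul; apply: eq_bigr => g _; apply: ffZr; apply: pf_lin.
Qed.

Lemma fam_form_Dw w w' x y : fam_form (vadd w w') x y = Cadd (fam_form w x y) (fam_form w' x y).
Proof.
by rewrite /fam_form -big_split; apply: eq_bigr => g _; apply: ffDw; apply: pf_lin.
Qed.

Lemma fam_form_Zw c w x y : fam_form (vscal c w) x y = Cmul c (fam_form w x y).
Proof.
by rewrite /fam_form Csum_mul; apply: eq_bigr => g _; apply: ffZw; apply: pf_lin.
Qed.

(** Over a common support, each summand is a positive functional evaluated at a congruence of Y, and
    congruences of Y stay in the cones. *)
Lemma Gcone_fam_form m (Y : mx ZC m m) (x : 'I_m -> fam) : Gcone K h Y ->
  0 <= re (\big[Cadd/C0]_(i < m) \big[Cadd/C0]_(j < m) fam_form (Y i j) (x j) (x i)).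
Proof.
move=> hY.
pose t := undup (flatten [seq fam_supp (x i) | i <- enum 'I_m]).
have ut : uniq t by apply: undup_uniq.
have st i : {subset fam_supp (x i) <= t}.
  move=> g hg; rewrite mem_undup; apply/flattenP; exists (fam_supp (x i)) => //.
  by apply: map_f; rewrite mem_enum.
under eq_bigr => i _.
  under eq_bigr => j _ do rewrite (fam_formE _ _ ut (st j)).
  rewrite exchange_big /=; over.
rewrite exchange_big /= re_sum; apply: Rsum_ge0 => g.
rewrite (functional_form_sum (pf_lin g) Y (fun i => x i g)) /=.
by apply: pf_pos; apply: Gcone_congr.
Qed.

Definition unitZC : ZC := (vzero Z, C1).

Lemma Gcone_fam_form1 (w : ZC) (x : fam) : Gcone K h (fun _ _ : 'I_1 => w) ->
  0 <= re (fam_form w x x).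
Proof. by move=> /(Gcone_fam_form (fun=> x)); rewrite !big_ord1. Qed.

Lemma Gcone_scalar (c : C) : 0 <= re c ->
  Gcone K h (fun _ _ : 'I_1 => (vzero Z, c) : ZC).
Proof.
move=> c0; have := Gcone_pair normalZ (K_0 normalZ 1) (@psd_scalar 1 c c0).
congr Gcone; apply: mx_eq => i j; congr pair.
by rewrite /scalar_mx !ord1.
Qed.

Lemma fam_form_ge0 x : 0 <= re (fam_form unitZC x x).
Proof. by apply/Gcone_fam_form1/Gcone_scalar => /=; lra. Qed.

(** Both (0, i) and (0, -i) lie in G_1, so the real part of i times the form has both signs and
    vanishes. *)
Lemma fam_form_im x : im (fam_form unitZC x x) = 0.
Proof.
have e c : ((vzero Z, c) : ZC) = vscal c unitZC.
  by congr pair; [rewrite /= vscalr0 | Cring].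
have := @Gcone_fam_form1 _ x (@Gcone_scalar Ci ltac:(rewrite /=; lra)).
have := @Gcone_fam_form1 _ x (@Gcone_scalar (Copp Ci) ltac:(rewrite /=; lra)).
rewrite !e !fam_form_Zw /=; lra.
Qed.

(** Hermitian symmetry by polarization: the diagonal is real at x + y and at x + i y. *)
Lemma fam_form_C x y : fam_form unitZC y x = Cconj (fam_form unitZC x y).
Proof.
have := fam_form_im (famD x y); have := fam_form_im (famD x (famZ Ci y)).
rewrite !fam_form_Dl !fam_form_Dr !fam_form_Zl !fam_form_Zr /= !fam_form_im => h1 h2.
by apply: Ceq => /=; lra.
Qed.

Definition fam_pre : preinner :=
  @Build_preinner fam fam0 famD famZ (fam_form unitZC)
    (fam_form_Dl unitZC) (fam_form_Zl unitZC) fam_form_C fam_form_ge0.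

(** The order unit gives t e - w in G_1 with t depending on w only, so the bound is uniform over all
    summands. *)
Lemma fam_form_le (w : ZC) : exists t, forall x : fam_pre,
  re (fam_form w x x) <= t * re (pform x x).
Proof.
have [t ht] := Gcone_order_unit normalZ (fun _ _ : 'I_1 => w).
exists t => x.
have := @Gcone_fam_form1 (vadd (vscal (RtoC t) unitZC) (vopp w)) x.
rewrite fam_form_Dw fam_form_Zw voppE fam_form_Zw /= => hx.
suff : Gcone K h (fun _ _ : 'I_1 => vadd (vscal (RtoC t) unitZC) (vscal (RtoC (-1)) w)).
  by move=> /hx; rewrite (fam_form_im x); lra.
move: ht; congr Gcone; apply: mx_eq => i j.
by rewrite -voppE /Gunit /mxadd /mxscal /pairmx /scalar_mx !ord1.
Qed.

(** The one-sided bounds for w, -w, iw and -iw control the modulus on the diagonal; polarization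
    does the rest. *)
Lemma fam_form_bounded (w : ZC) : exists M, 0 <= M /\
  forall x y : fam_pre, Cmod (fam_form w x y) <= M * (pnorm x * pnorm y).
Proof.
have [t1 h1] := fam_form_le w; have [t2 h2] := fam_form_le (vscal (RtoC (-1)) w).
have [t3 h3] := fam_form_le (vscal Ci w).
have [t4 h4] := fam_form_le (vscal (Copp Ci) w).
pose t := Rabs t1 + Rabs t2 + Rabs t3 + Rabs t4.
have := Rabs_pos t1; have := Rabs_pos t2; have := Rabs_pos t3; have := Rabs_pos t4.
move=> p4 p3 p2 p1; have t0 : 0 <= t by rewrite /t; lra.
exists (2 * t); split; first lra.
apply: polarization_bound => // [x y z|c x y|x y z|c x y|x].
- exact: fam_form_Dl.
- exact: fam_form_Zl.
- exact: fam_form_Dr.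
- exact: fam_form_Zr.
have := h1 x; have := h2 x; have := h3 x; have := h4 x; have x0 := pform_ge0 x.
rewrite !fam_form_Zw /= => k4 k3 k2 k1.
have q1 := Rmult_le_compat_r _ _ _ x0 (Rle_abs t1).
have q2 := Rmult_le_compat_r _ _ _ x0 (Rle_abs t2).
have q3 := Rmult_le_compat_r _ _ _ x0 (Rle_abs t3).
have q4 := Rmult_le_compat_r _ _ _ x0 (Rle_abs t4).
have r1 := Rmult_le_pos _ _ p1 x0; have r2 := Rmult_le_pos _ _ p2 x0.
have r3 := Rmult_le_pos _ _ p3 x0; have r4 := Rmult_le_pos _ _ p4 x0.
apply: Rle_trans (Cmod_le_reim _) _.
have : Rabs (re (fam_form w x x)) <= (Rabs t1 + Rabs t2) * re (pform x x).
  by apply: Rabs_le; rewrite /=; rewrite /= in q1 q2 r1 r2; lra.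
have : Rabs (im (fam_form w x x)) <= (Rabs t3 + Rabs t4) * re (pform x x).
  by apply: Rabs_le; rewrite /=; rewrite /= in q3 q4 r3 r4; lra.
rewrite /t /=; lra.
Qed.

Definition fam_bform (w : ZC) : bform fam_pre :=
  @Build_bform fam_pre (fam_form w) (fam_form_Dl w) (fam_form_Zl w) (fam_form_Dr w)
    (fam_form_Zr w) (fam_form_bounded w).

Lemma fam_opD w w' (f : afun fam_pre) : form_op (fam_bform (vadd w w')) f =
  afadd (form_op (fam_bform w) f) (form_op (fam_bform w') f).
Proof.
apply: afun_eq => y /=; rewrite -afinnerDr; congr afinner.
by apply: afun_eq => x /=; rewrite fam_form_Dw; Cring.
Qed.

Lemma fam_opZ c w (f : afun fam_pre) : form_op (fam_bform (vscal c w)) f =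
  afscal c (form_op (fam_bform w) f).
Proof.
apply: afun_eq => y /=.
have -> : bform_row (fam_bform (vscal c w)) y = afscal (Cconj c) (bform_row (fam_bform w) y).
  by apply: afun_eq => x /=; rewrite fam_form_Zw; Cring.
by rewrite afinnerZr; Cring.
Qed.

Lemma fam_op_unit (f : afun fam_pre) : form_op (fam_bform unitZC) f = f.
Proof.
apply: afun_eq => y /=; rewrite -reproducing; congr afinner.
by apply: afun_eq => x /=; rewrite -fam_form_C.
Qed.

Definition fam_map (z : Z) : Bop (completion fam_pre) := form_bop (fam_bform (z, C0)).

Lemma fam_map_linear : linear_map fam_map.
Proof.
split=> [z w f|c z f].
  rewrite -[RHS]fam_opD /=; congr form_op; congr fam_bform; congr pair; Cring.
rewrite -[RHS]fam_opZ /=; congr form_op; congr fam_bform; congr pair; Cring.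
Qed.

Lemma Gcone_completion m (Y : mx ZC m m) (f : 'I_m -> afun fam_pre) : Gcone K h Y ->
  0 <= re (\big[Cadd/C0]_(i < m) \big[Cadd/C0]_(j < m)
             afinner (form_op (fam_bform (Y i j)) (f j)) (f i)).
Proof.
move=> hY; apply: (form_ineq_completion (G := fun i j => fam_bform (Y i j))) => x.
exact: Gcone_fam_form.
Qed.

Lemma fam_map_accretive n (z : mx Z n n) : K z -> accretive_op (ampl fam_map z).
Proof.
move=> hz; apply/positive_ReM => f.
exact: (Gcone_completion f (Gcone_pair normalZ hz (@psd0 n))).
Qed.

(** Membership of (z, h(z) + e) in G_n reads Re <phi(z) f, f> + (h(z) + e) |f|^2 >= 0, because (0,
    1) acts as the identity. The e is there because h(z) may be 0. *)
Lemma qform_lower n (z : mx Z n n) (f : 'I_n -> completion fam_pre) :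
  - (h z * re (innerN f f)) <= re (qform (ampl fam_map z) f f).
Proof.
have N0 := innerN_ge0 f.
suff : - re (qform (ampl fam_map z) f f) - h z * re (innerN f f) <= 0 by lra.
apply: (@le_eps _ (re (innerN f f))) => e e0 _.
have hz := h_ge0 normalZ z.
have := Gcone_completion f (@Gcone_norm _ _ _ normalZ n z (h z + e) ltac:(lra) ltac:(lra)).
have -> : \big[Cadd/C0]_(i < n) \big[Cadd/C0]_(j < n)
    afinner (form_op (fam_bform (pairmx z (scalar_mx n (RtoC (h z + e))) i j)) (f j)) (f i) =
  Cadd (qform (ampl fam_map z) f f) (Cmul (RtoC (h z + e)) (innerN f f)).
  rewrite /innerN Csum_mul /qform -big_split; apply: eq_bigr => i _.
  have -> : Cmul (RtoC (h z + e)) (inner (f i) (f i)) =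
      \big[Cadd/C0]_(j < n) Cmul (scalar_mx n (RtoC (h z + e)) i j) (inner (f j) (f i)).
    rewrite (bigD1 i) //= big1 => [|j ji]; first by rewrite /scalar_mx eqxx; Cring.
    by rewrite /scalar_mx eq_sym (negbTE ji); Cring.
  rewrite -big_split; apply: eq_bigr => j _ /=.
  set c := scalar_mx _ _ _ _.
  have -> : pairmx z (scalar_mx n (RtoC (h z + e))) i j =
      vadd ((z i j, C0) : ZC) (vscal c unitZC).
    rewrite /pairmx /= -/c; congr pair; [by rewrite vscalr0 vaddr0 | Cring].
  by rewrite fam_opD fam_opZ fam_op_unit afinnerD afinnerZ.
rewrite /=; lra.
Qed.

Lemma qform_opp n (z : mx Z n n) (f : 'I_n -> completion fam_pre) :
  qform (ampl fam_map (mxopp z)) f f = Copp (qform (ampl fam_map z) f f).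
Proof.
have -> : Copp (qform (ampl fam_map z) f f) =
  Cmul (RtoC (-1)) (qform (ampl fam_map z) f f) by Cring.
rewrite /qform Csum_mul; apply: eq_bigr => i _; rewrite Csum_mul; apply: eq_bigr => j _.
rewrite -innerZl; congr inner; rewrite /ampl /mxopp voppE.
exact: (proj2 fam_map_linear).
Qed.

Lemma qform_bound n (z : mx Z n n) (f : 'I_n -> completion fam_pre) :
  Rabs (re (qform (ampl fam_map z) f f)) <= h z * re (innerN f f).
Proof.
have := qform_lower z f; have := qform_lower (mxopp z) f.
rewrite qform_opp (h_opp normalZ) /= => h1 h2; apply: Rabs_le; lra.
Qed.

(** * Recovering a functional from the unit vectors of its summand *)

Section UnitVectors.
Variable g : pfun.

(** Indices are compared as numbers, since a and i have different types as long as g' and g are not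
    known to be equal. *)
Definition delta_val (i : 'I_(pf_dim g)) (g' : pfun) (a : 'I_(pf_dim g')) : C :=
  if (g' == g) && (val a == val i) then C1 else C0.

Lemma delta_out i g' : g' \notin [:: g] -> forall a, @delta_val i g' a = C0.
Proof. by rewrite inE /delta_val => /negbTE ->. Qed.

Definition delta i : fam_pre := Build_fam (@delta_out i).

Lemma fam_form_delta w i j : fam_form w (delta i) (delta j) =
  functional_form (@pf_fun g) w (fun a => cmx1 _ i a) (fun a => cmx1 _ j a).
Proof.
rewrite /fam_form /= big_cons big_nil CaddC Cadd0 /pform_at /=.
have e k : delta_val k (g' := g) = (fun a => cmx1 _ k a).
  by apply/funext => a; rewrite /delta_val eqxx /cmx1 /= eq_sym.
by rewrite !e.
Qed.

(** The unit vectors are the rows of the identity matrix, so the congruence of Y is Y itself. *)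
Lemma fam_form_delta_sum (Y : mx ZC (pf_dim g) (pf_dim g)) :
  \big[Cadd/C0]_(i < pf_dim g) \big[Cadd/C0]_(j < pf_dim g)
    fam_form (Y i j) (delta j) (delta i) = complexify (@pf_fun g) Y.
Proof.
rewrite -[in RHS](congr_mx1 Y) -(functional_form_sum (pf_lin g)).
by apply: eq_bigr => i _; apply: eq_bigr => j _; rewrite fam_form_delta.
Qed.

Definition edelta (i : 'I_(pf_dim g)) : completion fam_pre := afemb (delta i).

Lemma qform_edelta (z : mx Z (pf_dim g) (pf_dim g)) :
  re (qform (ampl fam_map z) edelta edelta) = pf_fun (pairmx z (@mx0 complexCVS _ _)).
Proof.
rewrite /qform /ampl /fam_map /=.
rewrite -[RHS]/(re (complexify (@pf_fun g) (pairmx z (@mx0 complexCVS _ _)))).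
rewrite -fam_form_delta_sum.
congr re; apply: eq_bigr => i _; apply: eq_bigr => j _.
exact: (form_op_inner_emb (fam_bform _)).
Qed.

Lemma innerN_edelta : re (innerN edelta edelta) = pf_fun (Gunit Z (pf_dim g)).
Proof.
rewrite -[RHS]/(re (complexify (@pf_fun g) (Gunit Z _))) -fam_form_delta_sum.
congr re; apply: eq_bigr => i _.
rewrite (bigD1 i) //= big1 => [|j ji].
  rewrite CaddC Cadd0 reproducing /Gunit /pairmx /scalar_mx eqxx //.
have -> : Gunit Z (pf_dim g) i j = vscal C0 unitZC.
  rewrite /Gunit /pairmx /scalar_mx eq_sym (negbTE ji) /=; congr pair.
    by rewrite vscalr0.
  Cring.
by rewrite fam_form_Zw; Cring.
Qed.

End UnitVectors.

(** If adding elements of the cone never lowers h(z), separation with c = h(z) yields a functional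
    with value at least h(z) at z and at most 1 at the unit. Evaluating the hypothesis at its unit
    vectors gives h(z) <= c. *)
Lemma h_le_qform n (z : mx Z n n) c : 0 <= c ->
  (forall f : 'I_n -> completion fam_pre,
     Rabs (re (qform (ampl fam_map z) f f)) <= c * re (innerN f f)) -> h z <= c.
Proof.
case: n z => [|n] z c0 hc; first by rewrite (h_dim0 normalZ).
(* The hypothesis is symmetric in z and -z. If h(z + k) < h(z) for some k in K, normality applied to
   z - l, z, z + k forces h(z) <= h(z - l) for all l in K, so -z has the required property. *)
wlog hmin : z hc / forall k, K k -> h z <= h (mxadd z k) => [wl|].
  have [hm|/existsNP[k /not_implyP[hk /Rnot_le_lt zk]]] :=
    EM (forall k, K k -> h z <= h (mxadd z k)); first exact: wl.
  have hcN f : Rabs (re (qform (ampl fam_map (mxopp z)) f f)) <= c * re (innerN f f).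
    by rewrite qform_opp /= Rabs_Ropp.
  rewrite -(h_opp normalZ); apply: wl => // l hl.
  rewrite (h_opp normalZ).
  have nrm : h z <= Rmax (h (mxsub z l)) (h (mxadd z k)).
    case: normalZ => _ [_ [_ hn]]; apply: hn.
      suff -> : mxsub z (mxsub z l) = l by [].
      apply: mx_eq => i j; rewrite /mxsub /mxadd /mxopp voppD voppK vaddA vaddrN.
      exact: vadd0.
    suff -> : mxsub (mxadd z k) z = k by [].
    by apply: mx_eq => i j; rewrite /mxsub /mxadd /mxopp (vaddC (z i j)) vaddKN.
  have -> : h (mxadd (mxopp z) l) = h (mxsub z l).
    rewrite -(h_opp normalZ); congr h; apply: mx_eq => i j.
    by rewrite /mxsub /mxadd /mxopp voppD voppK.
  move: nrm; rewrite /Rmax; case: Rle_dec => _; lra.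
have [f [fl fp fu fz]] := Gcone_separation normalZ hmin.
pose g := @Build_pfun n.+1 f fl fp.
have := hc (@edelta g); rewrite (@qform_edelta g) (@innerN_edelta g) /=.
have := Rle_abs (f (pairmx z (@mx0 complexCVS n.+1 n.+1))); nra.
Qed.

(** For z outside K, a functional separating at -z is strictly negative at z, which contradicts
    accretivity at its unit vectors. *)
Lemma fam_map_accretive_inv n (z : mx Z n n) : accretive_op (ampl fam_map z) -> K z.
Proof.
case: n z => [|n] z; first by move=> _; apply: (K_dim0 normalZ).
move=> /positive_ReM hz; apply: contrapT => nz.
(* If no such d existed, elements of K at distance below 1 / (i + 1) from z would converge to z in
   h, and closedness would put z in K. *)
have [d d0 hd] : exists2 d, 0 < d & forall k, K k -> d <= h (mxadd (mxopp z) k).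
  apply: contrapT => nd.
  have hs (i : nat) : exists k, K k /\ h (mxadd (mxopp z) k) < / (INR i + 1).
    apply: contrapT => ni; apply: nd; exists (/ (INR i + 1)).
      by apply: Rinv_0_lt_compat; have := pos_INR i; lra.
    by move=> k hk; apply: Rnot_lt_le => hlt; apply: ni; exists k.
  have [s hs'] := choice hs.
  apply: nz; case: normalZ => _ [_ [hcl _]]; apply: (hcl _ s) => [i|e e0].
    by case: (hs' i).
  have [N hN] := archimed_cor1 e e0.
  exists N => i hi; rewrite /R_dist Rminus_0_r Rabs_right; last first.
    by apply/Rle_ge/(h_ge0 normalZ).
  have -> : mxsub (s i) z = mxadd (mxopp z) (s i).
    by apply: mx_eq => a b; rewrite /mxsub /mxadd /mxopp vaddC.
  apply: Rlt_trans (proj2 (hs' i)) _.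
  apply: Rle_lt_trans (proj1 hN).
  apply: Rinv_le_contravar; first by apply: lt_0_INR; case: hN.
  by have := le_INR _ _ hi; lra.
have [f [fl fp fu fz]] := Gcone_separation normalZ hd.
pose g := @Build_pfun n.+1 f fl fp.
have := hz (@edelta g).
have := f_equal re (qform_opp z (@edelta g)) => /= e.
have := @qform_edelta g (mxopp z) => /= e'; rewrite /= in fz; lra.
Qed.

(** The value h(u) = 0 alone only says that Re phi(u) = 0. Here every complex multiple of u = z - w
    is sent to 0, so h vanishes at all i^k u and properness of the gauge applies. *)
Lemma fam_map_inj z w : (forall f, fam_map z f = fam_map w f) -> z = w.
Proof.
move=> hzw.
pose u : mx Z 1 1 := fun _ _ => vadd z (vopp w).
have hu c : h (mxscal c u) = 0.
  apply: Rle_antisym; last exact: (h_ge0 normalZ).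
  apply: h_le_qform => [|f]; first lra.
  suff -> : qform (ampl fam_map (mxscal c u)) f f = C0 by rewrite /= Rabs_R0; lra.
  rewrite /qform big1 // => i _; rewrite big1 // => j _.
  rewrite /ampl /mxscal /u (proj2 fam_map_linear) (proj1 fam_map_linear) voppE.
  rewrite (proj2 fam_map_linear) hzw -voppE vaddrN vscalr0.
  exact: inner0l.
have u0 : u = @mx0 Z 1 1.
  by case: normalZ => _ [[_ [hp _]] _]; apply: hp => k _; apply: hu.
have := f_equal (fun M : mx Z 1 1 => M ord0 ord0) u0; rewrite /u /mx0 => e.
by rewrite -(vaddNK z w) e vadd0.
Qed.

(** Both inequalities go through the quadratic form: the upper bound since the norm of a
    self-adjoint operator is at most its numerical radius, the lower one since the numerical radius
    is at most the norm. *)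
Lemma fam_map_norm n (z : mx Z n n) : opnorm_is (ReM (ampl fam_map z)) (h z).
Proof.
have hz := h_ge0 normalZ z.
split=> [s [f [f1 ->]]|b hb].
  have := normN_ReM_le hz (qform_bound z) f.
  by have : 0 <= normN f by [apply: sqrt_pos]; nra.
have b0 : 0 <= b.
  apply: Rle_trans (sqrt_pos _) (hb _ _); exists (fun=> vzero _); split => //.
  rewrite /normN (_ : innerN _ _ = C0) /= ?sqrt_0; first lra.
  by rewrite /innerN big1 // => i _; apply: inner0l.
apply: h_le_qform => // f.
have f0 : 0 <= normN f by apply: sqrt_pos.
have ff : normN f * normN f = re (innerN f f) by rewrite /normN sqrt_sqrt //; apply: innerN_ge0.
have [fz|fnz] := Req_dec (normN f) 0.
  by have := qform_bound z f; rewrite -ff fz; lra.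
(* The supremum ranges over the unit ball, so f is rescaled to norm 1; the quadratic form then
   scales by r^2. *)
set r := / normN f.
have r0 : 0 < r by apply: Rinv_0_lt_compat; lra.
have rf : r * normN f = 1 by rewrite /r Rinv_l.
pose f' := scalN (RtoC r) f.
have nf' : normN f' = 1.
  have := @pnormZ (powpre (completion fam_pre) n) (RtoC r) f.
  by rewrite Cmod_RtoC Rabs_right; [move=> e; rewrite -rf; exact: e | lra].
have := qform_le_normN (ampl fam_map z) f'.
have hb' : normN (opmx (ReM (ampl fam_map z)) f') <= b.
  by apply: hb; exists f'; rewrite nf'; split; first lra.
rewrite nf' Rmult_1_r => /Rle_trans /(_ hb').
rewrite qform_Zl qform_Zr.
have -> : re (Cmul (RtoC r) (Cmul (Cconj (RtoC r)) (qform (ampl fam_map z) f f))) =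
  r * r * re (qform (ampl fam_map z) f f) by rewrite /=; ring.
rewrite Rabs_mult (Rabs_right (r * r)); last nra.
move=> hq; rewrite -ff.
have f2 : 0 <= normN f * normN f by nra.
have := Rmult_le_compat_r _ _ _ f2 hq.
have -> : r * r * Rabs (re (qform (ampl fam_map z) f f)) * (normN f * normN f) =
  (r * normN f) * (r * normN f) * Rabs (re (qform (ampl fam_map z) f f)) by ring.
rewrite rf; lra.
Qed.

End DirectSum.

Theorem theorem5p4 (Z : CVS) (K : forall n, mx Z n n -> Prop)
  (h : forall n, mx Z n n -> R) :
  normal_accretive_operator_space K h ->
  exists (H : Hilbert) (phi : Z -> Bop H),
    real_complete_order_embedding K phi /\
    forall n (z : mx Z n n), opnorm_is (ReM (ampl phi z)) (h n z).
Proof.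
move=> hZ; exists (completion (fam_pre hZ)), (fam_map hZ); split; last exact: fam_map_norm.
split; [split | split].
- exact: fam_map_linear.
- exact: fam_map_accretive.
- exact: fam_map_inj.
- exact: fam_map_accretive_inv.
Qed.
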